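(* Let $2 \le a \le m$ be integers, and let $X_1, \dots, X_m$ be independent real valued random variables. For every $A \in \binom{[m]}{\le a}$ let $f_A : \mathbb{R}^{|A|} \to \mathbb{R}$ be Borel measurable, and suppose that for every $A \in \binom{[m]}{\le a}$ we have (i) $\mathrm{E}\, f_A(X_A) = 0$, (ii) $|f_A(X_A)| \le e^{-c \cdot \mathrm{diam}\, A}$ (almost surely), and (iii) $\sigma_m^2 = \mathrm{E} \left( \sum_{A \in \binom{[m]}{\le a}} f_A(X_A) \right)^2 > 0$, for some constant $c>0$. Then for any real number $\lambda$, \[ \Pr \left( \frac{1}{\sigma_m} \sum_{A \in \binom{[m]}{\le a}} f_A(X_A) < \lambda \right) = \Phi(\lambda) + O \left( \sqrt[4]{\log m} \cdot \frac{m^{3/4}}{\sigma_m^2} \right) , \] where the implied constant in the error term depends only on $a$ and $c$.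
   Context: $[m] = \{1,2,\dots,m\}$ and $\binom{[m]}{\le a} = \{A \subseteq [m] : |A| \le a\}$. For a finite set $A$ of integers, $\mathrm{diam}\, A = \max A - \min A$. For random variables $X_1,\dots,X_m$ and $A \subseteq [m]$, $X_A = (X_i : i \in A)$. $\Phi(\lambda) = \int_{-\infty}^{\lambda} \frac{1}{\sqrt{2\pi}} e^{-x^2/2}\,\mathrm{d}x$ is the standard normal distribution function. *)

(* Defs.v *)
From HB Require Import structures.
From mathcomp Require Import all_boot all_order all_algebra.
From mathcomp Require Import all_classical all_reals all_analysis.

Set Implicit Arguments.
Unset Strict Implicit.
Unset Printing Implicit Defensive.

Import Order.TTheory GRing.Theory Num.Theory.
Import numFieldNormedType.Exports.

Local Open Scope classical_set_scope.
Local Open Scope ring_scope.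

(** The index set [{1, ..., m}] is represented by ['I_m = {0, ..., m - 1}];
    the diameter is invariant under this shift. *)

(** [max A - min A]. The default value [m] of the minimum exceeds every element
    of ['I_m], hence is only returned for the empty set, and then truncated
    subtraction gives [diam set0 = 0]. *)
Definition diam (m : nat) (A : {set 'I_m}) : nat :=
  (\max_(i in A) i - \big[minn/m]_(i in A) i)%N.

Definition mutually_independent (R : realType) (d : measure_display)
    (T : measurableType d) (P : probability T R) (m : nat)
    (X : 'I_m -> {RV P >-> R}) : Prop :=
  forall (J : {set 'I_m}) (B : 'I_m -> set R),
    (forall i, measurable (B i)) ->
    P [set w | forall i, i \in J -> B i (X i w)] =
    (\prod_(i in J) P (X i @^-1` B i))%E.

(** [X_A = (X_i : i in A)]; [enum_val] lists the elements of [A] in increasing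
    order. [R^|A|] is [#|A|.-tuple R], whose sigma-algebra is the one generated
    by the coordinate projections, i.e. the Borel one. *)
Definition subvector (T R : Type) (m : nat) (X : 'I_m -> T -> R)
    (A : {set 'I_m}) (w : T) : #|A|.-tuple R :=
  [tuple X (enum_val j) w | j < #|A|].

Definition Phi (R : realType) (lambda : R) : R :=
  \int[@lebesgue_measure R]_(x in `]-oo, lambda])
    ((Num.sqrt (2 * pi))^-1 * expR (- (x ^+ 2 / 2))).

(* Main.v *)
Require Import Defs.
From HB Require Import structures.
From mathcomp Require Import all_boot all_order all_algebra.
From mathcomp Require Import all_classical all_reals all_analysis.
From mathcomp Require Import measurable_realfun normal_distribution.
From mathcomp Require Import ring lra zify.

Set Implicit Arguments.
Unset Strict Implicit.
Unset Printing Implicit Defensive.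

Import Order.TTheory GRing.Theory Num.Theory.
Import numFieldNormedType.Exports.

Local Open Scope classical_set_scope.
Local Open Scope ring_scope.

(**
  Stein's method. After clamping, assume |f_A(X_A)| <= w_A := e^(-c diam A)
  everywhere.  Let S be the sum, W = S / sigma, and for a given A let N_A be the
  sum of the f_B(X_B) over the B meeting A; then f_A(X_A) and S - N_A are
  independent.  The exponential weights satisfy sum_(A containing i) w_A <= C
  with C = C(a, c), so although every A meets a huge number of other sets, the
  total weight of these sets is at most |A| C and no truncation (hence no
  logarithm) is needed.

  For a Lipschitz approximation h of the indicator of ]-oo, lambda[ at scale e,
  let F solve the Stein equation F' = w F + h - N(h).  Writing
    E W F(W) = (1 / sigma) sum_A E f_A(X_A) (F(W) - F(W - N_A / sigma)),
  a first-order Taylor expansion gives E F'(W) Q with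
  Q = sum_A f_A(X_A) N_A / sigma^2 up to O(m / (sigma^3 e)), while E Q = 1 and
  Var Q = O(m / sigma^4).  Hence E h(W) - N(h) is
  O(sqrt m / sigma^2 + m / (sigma^3 e)); the claim follows with
  e = m^(3/4) / sigma^2, since sigma^2 = O(m).
*)

(** * Summability of the weights *)

Lemma sum_geom_le (R : realType) (q : R) n : 0 <= q < 1 ->
  \sum_(0 <= k < n) q ^+ k <= (1 - q)^-1.
Proof.
move=> /andP[q0 q1]; have q1' : 0 < 1 - q by rewrite subr_gt0.
rewrite big_mkord -[leRHS]mul1r ler_pdivlMr// mulrC.
have -> : (1 - q) * (\sum_(i < n) q ^+ i) = 1 - q ^+ n.
  by rewrite -[RHS]opprB subrX1 -mulNr opprB.
by rewrite lerBlDr lerDl exprn_ge0.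
Qed.

(** Truncated subtraction kills one of the two terms, so this is the distance [|i - j|] computed
    within [nat]. *)
Definition distn (i j : nat) : nat := (i - j + (j - i))%N.

(** Splitting the range at [i] leaves one geometric sum on each side, whence the factor 2. *)
Lemma sum_geom_dist_le (R : realType) (q : R) m (i : 'I_m) : 0 <= q < 1 ->
  \sum_(j < m) q ^+ distn i j <= 2 / (1 - q).
Proof.
move=> q01; have q0 : 0 <= q by case/andP: q01.
rewrite -(big_mkord xpredT (fun j => q ^+ distn i j)).
rewrite (big_cat_nat (leq0n i) (ltnW (ltn_ord i)))/=.
have -> : 2 / (1 - q) = (1 - q)^-1 + (1 - q)^-1 by ring.
apply: lerD.
  (* Read backwards from [i], the left part has exponents starting at 1 instead of 0; the surplus
     factor [q] is at most 1 and is dropped. *)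
  rewrite big_nat_rev/=; apply: le_trans (sum_geom_le i q01).
  apply: ler_sum_nat => j /andP[_ ji].
  have -> : distn i (0 + i - j.+1) = j.+1 by rewrite /distn; lia.
  by rewrite exprS ler_piMl ?exprn_ge0//; case/andP: q01 => _ /ltW.
rewrite -{1}[nat_of_ord i]add0n big_addn.
rewrite (eq_bigr (fun j => q ^+ j)); first exact: sum_geom_le.
by move=> j _; congr (_ ^+ _); rewrite /distn; lia.
Qed.

Lemma distn_le_diam m (A : {set 'I_m}) (i j : 'I_m) :
  i \in A -> j \in A -> (distn i j <= diam A)%N.
Proof.
have mx k : k \in A -> (k <= \max_(i in A) i)%N.
  by move=> kA; exact: leq_bigmax_cond.
have mn k : k \in A -> (\big[minn/m]_(i in A) i <= k)%N.
  move=> kA.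
  exact: (@bigmin_le_cond _ nat _ m k (mem A) (fun i : 'I_m => i : nat) kA).
move=> iA jA; have := mx _ iA; have := mn _ iA; have := mx _ jA; have := mn _ jA.
by rewrite /distn /diam; lia.
Qed.

Section weights.
Variables (R : realType) (a : nat) (c : R) (m : nat).
Hypotheses (a0 : (0 < a)%N) (c0 : 0 < c).

(** The value 0 on sets with more than [a] elements lets all later sums range over every subset of
    ['I_m]. *)
Definition weight (A : {set 'I_m}) : R :=
  if (#|A| <= a)%N then expR (- (c * (diam A)%:R)) else 0.

(** With [q = expR (- (c / a))], the exponent is the bound for the sum of [q ^ |i - j|] over [j];
    the constant does not involve [m]. *)
Definition weight_const : R := expR (2 / (1 - expR (- (c / a%:R)))).

Lemma weight_ge0 A : 0 <= weight A.
Proof. by rewrite /weight; case: ifP => // _; exact: expR_ge0. Qed.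

(* Every point of [A] is within [diam A] of [i], so [a * diam A] dominates the
   sum of the distances to [i]. The resulting product makes the sum over all
   [A] containing [i] factorize into [\prod_j (1 + q ^ |i - j|)]. *)
Lemma weight_le_prod (A : {set 'I_m}) (i : 'I_m) : i \in A ->
  weight A <= \prod_(j in A) expR (- (c / a%:R)) ^+ distn i j.
Proof.
move=> iA; rewrite /weight; case: ifP => [Aa|_]; last first.
  by apply: prodr_ge0 => j _; rewrite exprn_ge0// expR_ge0.
under eq_bigr do rewrite -expRM_natl.
rewrite -expR_sum ler_expR -mulr_suml mulrN lerN2 -natr_sum.
rewrite mulrCA ler_wpM2l ?(ltW c0)// mulrC ler_pdivrMl ?ltr0n// -natrM ler_nat.
apply: (@leq_trans (\sum_(j in A) diam A)%N).
  by apply: leq_sum => j jA; exact: distn_le_diam.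
by rewrite sum_nat_const leq_mul2r Aa orbT.
Qed.

(** Enlarging the sum of products to all sets makes it the expansion of a product over the points
    [j]; then [1 + x <= expR x] reduces the claim to a geometric sum in the exponent. *)
Lemma sum_weight_le (i : 'I_m) :
  \sum_(A : {set 'I_m} | i \in A) weight A <= weight_const.
Proof.
set q := expR (- (c / a%:R)).
have q0 : 0 <= q by exact: expR_ge0.
have q1 : q < 1 by rewrite -expR0 ltr_expR oppr_lt0 divr_gt0// ltr0n.
apply: (@le_trans _ _ (\sum_(A : {set 'I_m}) \prod_(j in A) q ^+ distn i j)).
  rewrite big_mkcond/=; apply: ler_sum => A _.
  case: ifP => [iA|_]; first exact: weight_le_prod.
  by apply: prodr_ge0 => j _; rewrite exprn_ge0.
apply: (@le_trans _ _ (\prod_(j < m) (q ^+ distn i j + 1))).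
  rewrite bigA_distr/=; apply: ler_sum => A _.
  by rewrite [leLHS]big_mkcond.
apply: (@le_trans _ _ (\prod_(j < m) expR (q ^+ distn i j))).
  apply: ler_prod => j _; rewrite addr_ge0 ?exprn_ge0//=.
  by rewrite addrC expR_ge1Dx.
by rewrite -expR_sum ler_expR; apply: sum_geom_dist_le; rewrite q0.
Qed.

End weights.

(** * Bounded random variables and independence *)

Section bounded_expectation.
Context {R : realType} {d : measure_display} {T : measurableType d}.
Variable P : probability T R.
Implicit Types U V Z : T -> R.

(** Boundedness is required everywhere, not almost everywhere: the class is then closed under the
    algebraic operations pointwise, and integrability is automatic. *)
Definition bounded_rv Z :=
  measurable_fun setT Z /\ exists M : R, forall w, `|Z w| <= M.

Notation E Z := (Rintegral P setT Z).

Lemma bounded_rv_cst r : bounded_rv (fun=> r).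
Proof. by split; [exact: measurable_cst|exists `|r|]. Qed.

Lemma bounded_rvD U V : bounded_rv U -> bounded_rv V ->
  bounded_rv (fun w => U w + V w).
Proof.
move=> [mU [M UM]] [mV [N VN]]; split; first exact: measurable_funD.
by exists (M + N) => w; rewrite (le_trans (ler_normD _ _))// lerD.
Qed.

Lemma bounded_rvM U V : bounded_rv U -> bounded_rv V ->
  bounded_rv (fun w => U w * V w).
Proof.
move=> [mU [M UM]] [mV [N VN]]; split; first exact: measurable_funM.
by exists (M * N) => w; rewrite normrM ler_pM.
Qed.

Lemma bounded_rvN U : bounded_rv U -> bounded_rv (fun w => - U w).
Proof.
move=> bU; under eq_fun do rewrite -mulN1r.
exact: bounded_rvM (bounded_rv_cst _) bU.
Qed.

Lemma bounded_rvB U V : bounded_rv U -> bounded_rv V ->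
  bounded_rv (fun w => U w - V w).
Proof. by move=> bU bV; apply: bounded_rvD => //; exact: bounded_rvN. Qed.

Lemma bounded_rv_norm U : bounded_rv U -> bounded_rv (fun w => `|U w|).
Proof.
move=> [mU [M UM]]; split; first exact: measurableT_comp.
by exists M => w; rewrite normr_id.
Qed.

Lemma bounded_rv_sum (I : Type) (s : seq I) (p : pred I) (Z : I -> T -> R) :
  (forall i, bounded_rv (Z i)) -> bounded_rv (fun w => \sum_(i <- s | p i) Z i w).
Proof.
move=> bZ; elim: s => [|i s ih].
  by under eq_fun do rewrite big_nil; exact: bounded_rv_cst.
under eq_fun do rewrite big_cons.
by case: (p i) => //; exact: bounded_rvD.
Qed.

Lemma bounded_rv_integrable Z : bounded_rv Z -> P.-integrable setT (EFin \o Z).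
Proof.
move=> [mZ [M ZM]]; apply: measurable_bounded_integrable => //.
  exact: le_lt_trans (probability_le1 P measurableT) (ltry _).
exists M; split; first exact: num_real.
by move=> x Mx w _; exact: le_trans (ZM w) (ltW Mx).
Qed.

Lemma expect_EFin Z : bounded_rv Z -> (\int[P]_w (Z w)%:E)%E = (E Z)%:E.
Proof.
move=> bZ; rewrite fineK//; apply: integrable_fin_num => //.
exact: bounded_rv_integrable.
Qed.

Lemma expect_cst r : E (fun=> r) = r.
Proof. by rewrite Rintegral_cst//= probability_setT mulr1. Qed.

Lemma expectD U V : bounded_rv U -> bounded_rv V ->
  E (fun w => U w + V w) = E U + E V.
Proof. by move=> bU bV; rewrite RintegralD//; exact: bounded_rv_integrable. Qed.

Lemma expectB U V : bounded_rv U -> bounded_rv V ->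
  E (fun w => U w - V w) = E U - E V.
Proof. by move=> bU bV; rewrite RintegralB//; exact: bounded_rv_integrable. Qed.

Lemma expectZ r U : bounded_rv U -> E (fun w => r * U w) = r * E U.
Proof. by move=> bU; rewrite RintegralZl//; exact: bounded_rv_integrable. Qed.

Lemma expect_sum (I : Type) (s : seq I) (p : pred I) (Z : I -> T -> R) :
  (forall i, bounded_rv (Z i)) ->
  E (fun w => \sum_(i <- s | p i) Z i w) = \sum_(i <- s | p i) E (Z i).
Proof.
move=> bZ; elim: s => [|i s ih].
  by under eq_Rintegral do rewrite big_nil; rewrite expect_cst big_nil.
under eq_Rintegral do rewrite big_cons; rewrite big_cons.
by case: (p i) => //; rewrite expectD ?ih//; exact: bounded_rv_sum.
Qed.

Lemma expect_le U V : bounded_rv U -> bounded_rv V ->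
  (forall w, U w <= V w) -> E U <= E V.
Proof.
by move=> bU bV UV; apply: le_Rintegral => //; exact: bounded_rv_integrable.
Qed.

Lemma expect_norm_le U V : bounded_rv U -> bounded_rv V ->
  (forall w, `|U w| <= V w) -> `|E U| <= E V.
Proof.
move=> bU bV UV; apply: le_trans (le_normr_Rintegral _ _) _ => //.
  exact: bounded_rv_integrable.
by apply: expect_le => //; exact: bounded_rv_norm.
Qed.

Lemma expect_norm_le_cst U r : bounded_rv U -> (forall w, `|U w| <= r) ->
  `|E U| <= r.
Proof.
move=> bU Ur; rewrite -[leRHS]expect_cst.
by apply: expect_norm_le => //; exact: bounded_rv_cst.
Qed.

(** The Cauchy-Schwarz bound for the first moment, obtained from the nonnegativity of the variance
    of [|U|]. *)
Lemma expect_norm_le_sqrt U r : bounded_rv U ->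
  E (fun w => U w ^+ 2) <= r ^+ 2 -> 0 <= r -> E (fun w => `|U w|) <= r.
Proof.
move=> bU EU r0; set t := E _.
have bn := bounded_rv_norm bU.
have bt := bounded_rv_cst t.
have bB := bounded_rvB bn bt.
have : 0 <= E (fun w => (`|U w| - t) * (`|U w| - t)).
  rewrite -[leLHS](expect_cst 0); apply: expect_le => [| |w].
  - exact: bounded_rv_cst.
  - exact: bounded_rvM.
  - by rewrite -expr2 sqr_ge0.
have bU2 : bounded_rv (fun w => U w ^+ 2).
  by under eq_fun do rewrite expr2; exact: bounded_rvM.
have -> : (fun w => (`|U w| - t) * (`|U w| - t)) =
    (fun w => (U w ^+ 2 - (2 * t) * `|U w|) + t ^+ 2).
  by apply/funext => w; rewrite -[U w ^+ 2]real_normK ?num_real//; ring.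
have b2 := bounded_rvM (bounded_rv_cst (2 * t)) bn.
rewrite expectD ?expectB ?expectZ ?expect_cst//; first last.
- exact: bounded_rv_cst.
- exact: bounded_rvB.
rewrite -/t => H.
have : t ^+ 2 <= r ^+ 2 by rewrite !expr2 in EU H *; lra.
by rewrite ler_sqr// nnegrE//; apply: Rintegral_ge0.
Qed.

End bounded_expectation.

(** * Independence of set systems and the product rule for expectations *)

Section independence.
Context {R : realType} {d : measure_display} {T : measurableType d}.
Variable P : probability T R.
Implicit Types U V Z : T -> R.
Notation E Z := (Rintegral P setT Z).

Definition indep_systems (G H : set (set T)) :=
  forall A B, G A -> H B -> P (A `&` B) = (P A * P B)%E.

(** Dynkin's pi-lambda argument: for a fixed [A] in [G], the events independent of [A] are closed
    under complements ([PC]) and disjoint countable unions ([PU]), and they contain the pi-system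
    [H]. *)
Lemma indep_systems_gen (G H : set (set T)) :
  G `<=` measurable -> H `<=` measurable -> setI_closed H ->
  indep_systems G H -> indep_systems G <<s H >>.
Proof.
move=> Gm Hm HI GH A B GA sHB.
have sHm : <<s H >> `<=` (measurable : set (set T)).
  by apply: smallest_sub => //; exact: sigma_algebra_measurable.
have mA : measurable A := Gm _ GA. move: B sHB.
have EA : P A = (fine (P A))%:E by rewrite fineK// fin_num_measure.
have PC (B : set T) : measurable B -> P (A `&` B) = (P A * P B)%E ->
    P (A `&` ~` B) = (P A * P (~` B))%E.
  move=> mB PB; rewrite -setDE measureD//; last first.
    exact: le_lt_trans (probability_le1 P mA) (ltry _).
  rewrite [X in _ = (_ * X)%E]probability_setC// [X in (_ - X)%E]PB.
  have EB : P B = (fine (P B))%:E by rewrite fineK// fin_num_measure.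
  rewrite [X in (X - _)%E]EA EA EB -[1%E]/(1%:E).
  by rewrite -EFinM -!EFinB -EFinM mulrBr mulr1.
have PU (F : (set T)^nat) : (forall n, measurable (F n)) ->
    trivIset setT F -> (forall n, P (A `&` F n) = (P A * P (F n))%E) ->
    P (A `&` \bigcup_k F k) = (P A * P (\bigcup_k F k))%E.
  move=> mF tF PF; rewrite setI_bigcupr measure_bigcup//=; last 2 first.
    by move=> n _; exact: measurableI.
    apply/trivIsetP => i j _ _ ij.
    by rewrite setIACA setIid ((trivIsetP.1 tF) _ _ I I ij) setI0.
  rewrite measure_bigcup//= EA -nneseriesZl//.
  by apply: eq_eseriesr => n _; rewrite -EA; exact: PF.
apply: (@dynkin_induction _ (g_sigma_algebraType H)) => //.
- by rewrite setIT [X in (_ * X)%E]probability_setT mule1.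
- by move=> B HB; exact: GH.
- by move=> B /sHm; exact: PC.
- by move=> F mF; apply: PU => n; apply: sHm; exact: (mF n).
Qed.

Lemma indep_systems_sym (G H : set (set T)) :
  indep_systems G H -> indep_systems H G.
Proof. by move=> GH A B HA GB; rewrite setIC muleC GH. Qed.

(** By uniqueness of the product measure, the joint law of [(U, V)] is the product of the two
    marginal laws; Tonelli's theorem then separates the integral. *)
Lemma expectM_ge0 U V : measurable_fun setT U -> measurable_fun setT V ->
  (forall w, 0 <= U w) -> (forall w, 0 <= V w) ->
  (forall A B, measurable A -> measurable B ->
     P ((U @^-1` A) `&` (V @^-1` B)) = (P (U @^-1` A) * P (V @^-1` B))%E) ->
  (\int[P]_w (U w * V w)%:E = (\int[P]_w (U w)%:E) * (\int[P]_w (V w)%:E))%E.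
Proof.
move=> mU mV U0 V0 UV.
pose U' : {mfun T >-> R} := mfun_Sub (mem_set mU : U \in mfun).
pose V' : {mfun T >-> R} := mfun_Sub (mem_set mV : V \in mfun).
have mUV : measurable_fun setT (fun w => (U w, V w)).
  exact: measurable_fun_pair.
pose W' : {mfun T >-> (R * R)%type} := mfun_Sub (mem_set mUV : _ \in mfun).
pose m1 := distribution P U'; pose m2 := distribution P V'.
pose m := distribution P W'.
(* The positive parts make the integrand nonnegative on the whole plane, as Tonelli requires,
   without changing it on the range of [(U, V)]. *)
pose F (z : R * R) : \bar R := (Num.max z.1 0 * Num.max z.2 0)%:E.
have mF : measurable_fun setT F.
  apply/measurable_EFinP/measurable_funM.
    exact: measurable_maxr.
  exact: measurable_maxr.
have F0 z : (0 <= F z)%E.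
  by rewrite lee_fin mulr_ge0// le_max lexx orbT.
have mx : measurable_fun setT (fun x : R => (Num.max x 0)%:E).
  by apply/measurable_EFinP; exact: measurable_maxr.
have mx0 (x : R) : (0 <= (Num.max x 0)%:E)%E by rewrite lee_fin le_max lexx orbT.
transitivity (\int[m]_z F z)%E.
  rewrite ge0_integral_distribution//; apply: eq_integral => w _ /=.
  by rewrite /F /= !max_l.
transitivity (\int[m1 \x m2]_z F z)%E.
  apply: eq_measure_integral => A mA _.
  by apply/esym/product_measure_unique => // B C mB mC; exact: UV.
rewrite fubini_tonelli1// /fubini_F.
transitivity (\int[m1]_x ((Num.max x 0)%:E * \int[m2]_y (Num.max y 0)%:E))%E.
  apply: eq_integral => x _; rewrite -ge0_integralZl//.
rewrite ge0_integralZr//; last exact: integral_ge0.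
rewrite !ge0_integral_distribution//.
by congr (_ * _)%E; apply: eq_integral => w _ /=; rewrite max_l.
Qed.

(* Shifting by the bounds of [U] and [V] reduces to Tonelli's theorem. *)
Lemma expectM_indep U V : bounded_rv U -> bounded_rv V ->
  (forall A B, measurable A -> measurable B ->
     P ((U @^-1` A) `&` (V @^-1` B)) = (P (U @^-1` A) * P (V @^-1` B))%E) ->
  E (fun w => U w * V w) = E U * E V.
Proof.
move=> bU bV UV; have [mU [M UM]] := bU; have [mV [N VN]] := bV.
have bM := @bounded_rv_cst R _ T M; have bN := @bounded_rv_cst R _ T N.
have bUM := bounded_rvD bU bM; have bVN := bounded_rvD bV bN.
have := @expectM_ge0 (fun w => U w + M) (fun w => V w + N).
move=> /(_ bUM.1 bVN.1).
rewrite !expect_EFin//; last exact: bounded_rvM.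
rewrite -EFinM => H.
have {}H : E (fun w => (U w + M) * (V w + N)) =
    E (fun w => U w + M) * E (fun w => V w + N).
  apply: EFin_inj; apply: H.
  - by move=> w; have := UM w; rewrite ler_norml => /andP[]; lra.
  - by move=> w; have := VN w; rewrite ler_norml => /andP[]; lra.
  - move=> A B mA mB.
    have := UV [set x | A (x + M)] [set x | B (x + N)]; apply.
      rewrite -[X in measurable X]setTI.
      have mf : measurable_fun setT (fun x : R => x + M).
        exact: measurable_funD.
      exact: mf.
    rewrite -[X in measurable X]setTI.
    have mf : measurable_fun setT (fun x : R => x + N).
      exact: measurable_funD.
    exact: mf.
move: H; rewrite !expectD// !expect_cst.
have -> : (fun w => (U w + M) * (V w + N)) =
    (fun w => (U w * V w + M * V w) + (N * U w + M * N)).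
  by apply/funext => w; ring.
have bUV := bounded_rvM bU bV.
have bMV := bounded_rvM bM bV.
have bNU := bounded_rvM bN bU.
have bMN := bounded_rvM bM bN.
rewrite (expectD P (bounded_rvD bUV bMV) (bounded_rvD bNU bMN)).
rewrite (expectD P bUV bMV) (expectD P bNU bMN).
by rewrite !expectZ// expect_cst => H; lra.
Qed.

End independence.

(** * Sigma-algebras generated by subfamilies of the independent variables *)

Section cylinders.
Context {R : realType} {d : measure_display} {T : measurableType d}.
Variables (P : probability T R) (m : nat) (X : 'I_m -> {RV P >-> R}).
Hypothesis hX : mutually_independent X.
Implicit Types (J : {set 'I_m}) (Z : T -> R).
Notation E Z := (Rintegral P setT Z).

(** A pi-system generating the sigma-algebra of [(X_i : i \in J)], consisting of exactly the events
    to which [mutually_independent] applies. *)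
Definition cylinders J : set (set T) :=
  [set S | exists2 B : 'I_m -> set R, (forall i, measurable (B i)) &
    S = [set w | forall i, i \in J -> B i (X i w)]].

(* Measurability with respect to the sigma-algebra of [(X_i : i \in J)]. *)
Definition cyl_measurable J Z :=
  @measurable_fun _ _ (g_sigma_algebraType (cylinders J)) R setT Z.

Lemma cylinders_measurable J : cylinders J `<=` measurable.
Proof.
move=> _ [B mB ->].
have -> : [set w | forall i, i \in J -> B i (X i w)] =
    \bigcap_(i in [set` J]) (X i @^-1` B i) by [].
apply: fin_bigcap_measurable => // i _.
by rewrite -[X in measurable X]setTI; exact: measurable_funPT.
Qed.

Lemma cylinders_setI J : setI_closed (cylinders J).
Proof.
move=> _ _ [B mB ->] [C mC ->]; exists (fun i => B i `&` C i).
  by move=> i; exact: measurableI.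
apply/seteqP; split => w /=.
  by move=> [wB wC] i iJ; split; [exact: wB|exact: wC].
by move=> wBC; split => i iJ; have [] := wBC i iJ.
Qed.

Lemma cylinders_sub J J' : J \subset J' -> cylinders J `<=` cylinders J'.
Proof.
move=> /fintype.subsetP JJ' _ [B mB ->].
exists (fun i => if i \in J then B i else setT); first by move=> i; case: ifP.
apply/seteqP; split => w /= wB i.
  by case: ifP => // iJ _; exact: wB.
by move=> iJ; have := wB i (JJ' _ iJ); rewrite iJ.
Qed.

Lemma cyl_measurableW J Z : cyl_measurable J Z -> measurable_fun setT Z.
Proof.
move=> mZ mT B mB; have := mZ measurableT B mB.
apply: smallest_sub; first exact: sigma_algebra_measurable.
exact: cylinders_measurable.
Qed.

Lemma cyl_measurable_sub J J' Z : J \subset J' ->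
  cyl_measurable J Z -> cyl_measurable J' Z.
Proof.
move=> JJ' mZ mT B mB; have := mZ measurableT B mB.
by apply: sub_sigma_algebra2; exact: cylinders_sub.
Qed.

Lemma cyl_measurable_coord J i : i \in J -> cyl_measurable J (X i).
Proof.
move=> iJ mT B mB; rewrite setTI; apply: sub_sigma_algebra.
exists (fun j => if j == i then B else setT); first by move=> j; case: ifP.
apply/seteqP; split => w /=; last by move=> /(_ i iJ); rewrite eqxx.
by move=> wB j _; case: eqP => // ->.
Qed.

Lemma cyl_measurable_subvector J (f : #|J|.-tuple R -> R) :
  measurable_fun setT f -> cyl_measurable J (fun w => f (subvector X J w)).
Proof.
move=> mf; apply: (measurableT_comp mf).
apply/measurable_fun_tnthP => j.
have -> : (@tnth _ R ^~ j) \o subvector X J = X (enum_val j).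
  by apply/funext => w /=; rewrite tnth_mktuple.
apply: cyl_measurable_coord; exact: enum_valP.
Qed.

Lemma cyl_measurable_sum (I : Type) (s : seq I) (p : pred I) J (Z : I -> T -> R) :
  (forall i, p i -> cyl_measurable J (Z i)) ->
  cyl_measurable J (fun w => \sum_(i <- s | p i) Z i w).
Proof.
move=> mZ; elim: s => [|i s ih].
  by under eq_fun do rewrite big_nil; exact: measurable_cst.
under eq_fun do rewrite big_cons.
by case pi : (p i) => //; apply: measurable_funD => //; exact: mZ.
Qed.

Lemma indep_cylinders J J' : (forall i, i \in J -> i \notin J') ->
  indep_systems P (cylinders J) (cylinders J').
Proof.
move=> JJ' _ _ [B mB ->] [C mC ->].
(* The two cylinders merge into one over [J :|: J']; by disjointness [D] agrees with [C] on [J'], so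
   the product formula for the union splits. *)
pose D i := if i \in J then B i else C i.
have mD i : measurable (D i) by rewrite /D; case: ifP.
rewrite [X in P X](_ : _ =
    [set w | forall i, i \in J :|: J' -> D i (X i w)]%classic); last first.
  apply/seteqP; split => w /=.
    move=> [wB wC] i; rewrite inE /D; case: ifP => [iJ _|_ /= iJ'].
      exact: wB.
    exact: wC.
  move=> wD; split=> i iJ.
    by have := wD i; rewrite inE /D iJ; exact.
  by have := wD i; rewrite inE /D iJ orbT (contraTF (JJ' i) iJ); exact.
rewrite !hX//.
rewrite (eq_bigl [in [predU J & J']]); last by move=> i; rewrite !inE.
rewrite bigU//=; last by apply/pred0P => i /=; apply/andP => -[/JJ'/negP].
congr (_ * _)%E; apply: eq_bigr => i iJ.
  by rewrite /D iJ.
by rewrite /D (contraTF (JJ' i) iJ).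
Qed.

(** Independence passes from cylinders to the generated sigma-algebras one side at a time, using the
    symmetry of the relation for the other side. *)
Lemma expectM_cyl J J' U V : (forall i, i \in J -> i \notin J') ->
  bounded_rv U -> bounded_rv V -> cyl_measurable J U -> cyl_measurable J' V ->
  E (fun w => U w * V w) = E U * E V.
Proof.
move=> JJ' bU bV mU mV; apply: expectM_indep => // A B mA mB.
have sub K : <<s cylinders K >> `<=` (measurable : set (set T)).
  apply: smallest_sub; first exact: sigma_algebra_measurable.
  exact: cylinders_measurable.
apply: (@indep_systems_gen _ _ _ P <<s cylinders J>> (cylinders J')).
- exact: sub.
- exact: cylinders_measurable.
- exact: cylinders_setI.
- apply: indep_systems_sym; apply: indep_systems_gen.
  + exact: cylinders_measurable.
  + exact: cylinders_measurable.
  + exact: cylinders_setI.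
  + by apply: indep_systems_sym; exact: indep_cylinders.
- by have := mU measurableT A mA; rewrite setTI.
- by have := mV measurableT B mB; rewrite setTI.
Qed.

End cylinders.

(** * The Stein equation *)

Section gaussian_tails.
Context {R : realType}.
Notation mu := (@lebesgue_measure R).
Implicit Types x w : R.

Definition gauss_pdf : R -> R := normal_pdf 0 1.

Lemma gauss_pdfE x :
  gauss_pdf x = (Num.sqrt (2 * pi))^-1 * expR (- (x ^+ 2 / 2)).
Proof.
rewrite /gauss_pdf normal_pdfE ?oner_eq0// /normal_peak /normal_fun.
rewrite subr0 expr1n mul1r.
by rewrite -[pi *+ 2]mulr_natl !mulNr expr2.
Qed.

Lemma gauss_pdf_gt0 x : 0 < gauss_pdf x.
Proof.
rewrite gauss_pdfE mulr_gt0 ?expR_gt0// invr_gt0 sqrtr_gt0 mulr_gt0//.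
exact: pi_gt0.
Qed.

Lemma gauss_pdf_le1 x : gauss_pdf x <= 1.
Proof.
rewrite gauss_pdfE mulr_ile1 ?expR_ge0 ?invr_ge0 ?sqrtr_ge0//; last first.
  by rewrite expR_le1 oppr_le0 mulr_ge0// sqr_ge0.
rewrite invf_le1 ?sqrtr_gt0 ?mulr_gt0 ?pi_gt0//.
rewrite -[leLHS]sqrtr1 ler_wsqrtr//.
by have := @pi_ge2 R; lra.
Qed.

Lemma continuous_gauss_pdf : continuous gauss_pdf.
Proof. by apply: continuous_normal_pdf; rewrite oner_eq0. Qed.

Lemma measurable_gauss_pdf (D : set R) : measurable_fun D gauss_pdf.
Proof. apply: measurable_funTS; exact: measurable_normal_pdf. Qed.

Lemma integrable_gauss_pdf (D : set R) : measurable D ->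
  mu.-integrable D (EFin \o gauss_pdf).
Proof.
move=> mD; apply: (@integrableS _ _ _ _ setT) => //.
exact: integrable_normal_pdf.
Qed.

Lemma Rintegral_gauss_pdf : \int[mu]_x gauss_pdf x = 1.
Proof. by rewrite /Rintegral integral_normal_pdf. Qed.

Lemma is_derive_gauss_pdf x : is_derive x 1 gauss_pdf (- x * gauss_pdf x).
Proof.
have -> : gauss_pdf =
    (Num.sqrt (2 * pi))^-1 \*: (expR \o (fun y => - (y ^+ 2 / 2))).
  by apply/funext => y; rewrite gauss_pdfE.
have H : is_derive x 1 (fun y : R => - (y ^+ 2 / 2)) (- x).
  have -> : (fun y : R => - (y ^+ 2 / 2)) = (- 2^-1) \*: ((@id R) ^+ 2).
    by apply/funext => y /=; rewrite /GRing.scale/= exprfctE; field.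
  by apply: is_derive_eq; rewrite /= /GRing.scale/=; field.
have H' := is_derive1_comp (is_derive_expR _) H.
apply: is_derive_eq; rewrite /GRing.scale/=.
rewrite [RHS](_ : _ = - x * ((Num.sqrt (2 * pi))^-1 * expR (- (x ^+ 2 / 2))))//.
by ring.
Qed.

Lemma gauss_pdf_even x : gauss_pdf (- x) = gauss_pdf x.
Proof. by rewrite !gauss_pdfE sqrrN. Qed.

Lemma gauss_pdf_cvg0 : gauss_pdf x @[x --> +oo] --> (0 : R).
Proof.
have -> : gauss_pdf = fun x => (Num.sqrt (2 * pi))^-1 * expR (- (x ^+ 2 / 2)).
  by apply/funext => y; rewrite gauss_pdfE.
rewrite -[X in _ --> X](mulr0 (Num.sqrt (2 * pi))^-1).
apply: cvgM; first exact: cvg_cst.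
apply: (cvg_comp (fun x => x ^+ 2 / 2) (fun x => expR (- x)));
  last exact: cvgr_expR.
by apply: gt0_cvgMly; [rewrite invr_gt0|exact: cvgr_expr2].
Qed.

(* Mills' bound: replace [w] by [x] under the integral, [- gauss_pdf] being a
   primitive of [x * gauss_pdf x]. *)
Lemma gauss_upper_tail w : 0 < w ->
  w * \int[mu]_(x in `[w, +oo[) gauss_pdf x <= gauss_pdf w.
Proof.
move=> w0.
have cxp : continuous (fun x : R => x * gauss_pdf x).
  by move=> x; apply: cvgM; [exact: cvg_id|exact: continuous_gauss_pdf].
have dN x : is_derive x 1 (fun y => - gauss_pdf y) (x * gauss_pdf x).
  have H := is_derive_gauss_pdf x.
  have -> : (fun y => - gauss_pdf y) = - gauss_pdf by [].
  by apply: is_derive_eq; rewrite mulNr opprK.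
have E : (\int[mu]_(x in `[w, +oo[) (x * gauss_pdf x)%:E = (gauss_pdf w)%:E)%E.
  rewrite (@ge0_continuous_FTC2y _ _ (fun y => - gauss_pdf y) w 0).
  - by rewrite -EFinB sub0r opprK.
  - move=> x wx; rewrite mulr_ge0 ?(ltW (gauss_pdf_gt0 x))//.
    exact: le_trans (ltW w0) wx.
  - exact: continuous_subspaceT.
  - by rewrite -oppr0; apply: cvgN; exact: gauss_pdf_cvg0.
  - by move=> x _; exact: (@ex_derive _ _ _ _ _ _ _ (dN x)).
  - by apply: cvg_at_right_filter; apply: cvgN; exact: continuous_gauss_pdf.
  - by move=> x _; rewrite derive1E; exact: (@derive_val _ _ _ _ _ _ _ (dN x)).
rewrite -lee_fin -E -RintegralZl//; last exact: integrable_gauss_pdf.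
have iw := integrable_gauss_pdf (measurable_itv `[w, +oo[).
rewrite /Rintegral fineK; last first.
  under eq_integral do rewrite EFinM.
  rewrite integralZl// fin_numM//; exact: integrable_fin_num.
apply: ge0_le_integral => //=.
- move=> x _; rewrite lee_fin mulr_ge0 ?(ltW w0)//; exact/ltW/gauss_pdf_gt0.
- apply/measurable_EFinP/measurable_funM => //; exact: measurable_gauss_pdf.
- apply/measurable_EFinP/measurable_funM => //; exact: measurable_gauss_pdf.
- move=> x; rewrite in_itv/= andbT => wx.
  by rewrite lee_fin ler_wpM2r//; exact/ltW/gauss_pdf_gt0.
Qed.

Lemma gauss_lower_tail w : 0 < w ->
  \int[mu]_(x in `]-oo, - w]) gauss_pdf x = \int[mu]_(x in `[w, +oo[) gauss_pdf x.
Proof.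
move=> w0; rewrite /Rintegral ge0_integration_by_substitutionNy.
- by congr fine; apply: eq_integral => x _ /=; rewrite gauss_pdf_even.
- by apply: continuous_subspaceT; exact: continuous_gauss_pdf.
- by move=> x _; exact/ltW/gauss_pdf_gt0.
Qed.

End gaussian_tails.

(** * The solution of the Stein equation and its bounds *)

Section stein_equation.
Context {R : realType}.
Notation mu := (@lebesgue_measure R).
Notation p := (@gauss_pdf R).
Variables (h : R -> R).
Hypotheses (ch : continuous h) (h01 : forall x, 0 <= h x <= 1).

Definition gauss_mean : R := \int[mu]_x (h x * p x).

Definition stein_primitive (w : R) : R :=
  \int[mu]_(x in `]-oo, w]) ((h x - gauss_mean) * p x).

(** Variation of constants: the second factor is the reciprocal of the normal density at [w],
    written so that its derivative is immediate. *)
Definition stein_sol (w : R) : R :=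
  stein_primitive w * (Num.sqrt (2 * pi) * expR (w ^+ 2 / 2)).

(** The right-hand side of the Stein equation; [is_derive_stein_sol] identifies it with the
    derivative of [stein_sol]. *)
Definition stein_deriv (w : R) : R := w * stein_sol w + (h w - gauss_mean).

Definition stein_bound : R := 1 + (p 1)^-1.

Let p_ge0 x : 0 <= p x. Proof. exact/ltW/gauss_pdf_gt0. Qed.

Let continuous_hp : continuous (fun x => (h x - gauss_mean) * p x).
Proof.
move=> x; apply: cvgM; last exact: continuous_gauss_pdf.
by apply: cvgB; [exact: ch|exact: cvg_cst].
Qed.

Let integrable_bdp (g : R -> R) (D : set R) : measurable D ->
  measurable_fun setT g -> (forall x, `|g x| <= 1) ->
  mu.-integrable D (EFin \o (fun x => g x * p x)).
Proof.
move=> mD mg g1; apply: (@le_integrable _ _ _ mu D mD _ (EFin \o p));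
  last exact: integrable_gauss_pdf.
  apply/measurable_EFinP/measurable_funM; last exact: measurable_gauss_pdf.
  exact: measurable_funTS.
by move=> x _ /=; rewrite lee_fin normrM ler_piMl.
Qed.

Let mh : measurable_fun setT h. Proof. exact: continuous_measurable_fun. Qed.

Let integrable_hp D : measurable D ->
  mu.-integrable D (EFin \o (fun x => h x * p x)).
Proof.
move=> mD; apply: integrable_bdp => // x.
by have /andP[? ?] := h01 x; rewrite ger0_norm.
Qed.

Lemma gauss_mean_ge0_le1 : 0 <= gauss_mean <= 1.
Proof.
apply/andP; split.
  apply: Rintegral_ge0 => x _; rewrite mulr_ge0//; by case/andP: (h01 x).
rewrite -[leRHS]Rintegral_gauss_pdf; apply: le_Rintegral => //.
- exact: integrable_hp.
- exact: integrable_gauss_pdf.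
- move=> x _; rewrite ler_piMl//; by case/andP: (h01 x).
Qed.

Lemma norm_hB_le1 x : `|h x - gauss_mean| <= 1.
Proof.
have := h01 x; have := gauss_mean_ge0_le1.
by rewrite ler_norml => /andP[? ?] /andP[? ?]; apply/andP; split; lra.
Qed.

Let integrable_hBp D : measurable D ->
  mu.-integrable D (EFin \o (fun x => (h x - gauss_mean) * p x)).
Proof.
move=> mD; apply: integrable_bdp => //; last exact: norm_hB_le1.
exact: measurable_funB.
Qed.

Let norm_int_le D : measurable D ->
  `|\int[mu]_(x in D) ((h x - gauss_mean) * p x)| <= \int[mu]_(x in D) p x.
Proof.
move=> mD; apply: le_trans (le_normr_Rintegral mD (integrable_hBp mD)) _.
apply: le_Rintegral => //.
- have := integrable_norm (integrable_hBp mD); exact.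
- exact: integrable_gauss_pdf.
- by move=> x _; rewrite normrM (ger0_norm (p_ge0 x)) ler_piMl// norm_hB_le1.
Qed.

Let int_hBp0 : \int[mu]_x ((h x - gauss_mean) * p x) = 0.
Proof.
under eq_Rintegral do rewrite mulrBl.
rewrite RintegralB//; first last.
- apply: integrable_bdp => // x.
  by have /andP[? ?] := gauss_mean_ge0_le1; rewrite ger0_norm.
- exact: integrable_hp.
rewrite RintegralZl//; last exact: integrable_gauss_pdf.
by rewrite Rintegral_gauss_pdf mulr1 subrr.
Qed.

(** The total integral of [(h - gauss_mean) * p] vanishes, so the primitive may also be computed
    from the upper tail, which is the small one for positive [w]. *)
Let primitive_upper w : stein_primitive w =
  - \int[mu]_(x in `]w, +oo[) ((h x - gauss_mean) * p x).
Proof.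
have := @Rintegral_itvB R (fun x => (h x - gauss_mean) * p x) -oo%O +oo%O w.
rewrite set_itvE int_hBp0 sub0r => <- //.
- by rewrite opprK.
- exact: integrable_hBp.
Qed.

Let primitive_le1 w : `|stein_primitive w| <= 1.
Proof.
apply: le_trans (norm_int_le _) _ => //.
rewrite -[leRHS]Rintegral_gauss_pdf [leLHS]Rintegral_mkcond.
apply: le_Rintegral => //.
- rewrite -restrict_EFin; apply/integrable_restrict => //; rewrite setTI.
  exact: integrable_gauss_pdf.
- exact: integrable_gauss_pdf.
- by move=> x _; rewrite patchE; case: ifP.
Qed.

(** The sign of [w] selects the tail to integrate over; since [|h - gauss_mean| <= 1], Mills' bound
    applies to it. *)
Let norm_w_primitive_le w : `|w * stein_primitive w| <= p w.
Proof.
rewrite normrM; have [w0|w0|->] := ltgtP w 0; last by rewrite normr0 mul0r.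
- rewrite ltr0_norm//; have nw0 : 0 < - w by rewrite oppr_gt0.
  apply: (@le_trans _ _ (- w * \int[mu]_(x in `]-oo, w]) p x)).
    by rewrite ler_wpM2l ?(ltW nw0)//; exact: norm_int_le.
  have := gauss_upper_tail nw0; have := gauss_lower_tail nw0.
  by rewrite opprK gauss_pdf_even => <-.
- rewrite gtr0_norm// primitive_upper normrN.
  apply: (@le_trans _ _ (w * \int[mu]_(x in `]w, +oo[) p x)).
    by rewrite ler_wpM2l ?(ltW w0)//; exact: norm_int_le.
  rewrite Rintegral_itv_obnd_cbnd; first exact: gauss_upper_tail.
  exact: integrable_gauss_pdf.
Qed.

Let inv_p w : Num.sqrt (2 * pi) * expR (w ^+ 2 / 2) = (p w)^-1.
Proof. by rewrite gauss_pdfE invfM invrK -expRN opprK. Qed.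

Lemma norm_w_stein_sol_le1 w : `|w * stein_sol w| <= 1.
Proof.
rewrite /stein_sol inv_p mulrA normrM (@ger0_norm _ (p w)^-1) ?invr_ge0//.
by rewrite ler_pdivrMr ?gauss_pdf_gt0// mul1r.
Qed.

(** For [|w| <= 1] the primitive is at most 1 and [p w >= p 1]; for [|w| > 1] the bound on
    [w * stein_sol w] is stronger. The two cases account for the two terms of [stein_bound]. *)
Lemma norm_stein_sol_le w : `|stein_sol w| <= stein_bound.
Proof.
have p1 : 0 <= (p 1)^-1 by rewrite invr_ge0.
have [w1|w1] := leP `|w| 1.
  rewrite /stein_sol inv_p normrM (@ger0_norm _ (p w)^-1) ?invr_ge0//.
  apply: (@le_trans _ _ (p w)^-1); first by rewrite ler_piMl ?invr_ge0.
  apply: (@le_trans _ _ (p 1)^-1); last by rewrite lerDr.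
  rewrite lef_pV2 ?posrE ?gauss_pdf_gt0// !gauss_pdfE.
  rewrite ler_wpM2l ?invr_ge0 ?sqrtr_ge0//.
  rewrite ler_expR lerN2 ler_pM2r// -[w ^+ 2]real_normK ?num_real//.
  by rewrite ler_sqr ?nnegrE.
apply: (@le_trans _ _ 1); last by rewrite lerDl.
have := norm_w_stein_sol_le1 w; rewrite normrM; apply: le_trans.
by rewrite ler_peMl// ltW.
Qed.

Lemma norm_stein_deriv_le w : `|stein_deriv w| <= 2.
Proof.
apply: le_trans (ler_normD _ _) _.
by have := norm_w_stein_sol_le1 w; have := norm_hB_le1 w; lra.
Qed.

(** The fundamental theorem of calculus differentiates the primitive, where the reciprocal density
    cancels [p w]; differentiating the other factor produces [w * stein_sol w]. *)
Lemma is_derive_stein_sol (w : R) : is_derive w 1 stein_sol (stein_deriv w).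
Proof.
have ww : w < w + 1 by rewrite ltrDl.
have iw := integrable_hBp (measurable_itv `]-oo, w + 1]).
have [dG G'] := continuous_FTC1 ww iw (ltNyr w) (@continuous_hp w).
have dG' : is_derive w 1 stein_primitive ((h w - gauss_mean) * p w).
  by split => //; rewrite -derive1E.
have H : is_derive w 1 (fun y : R => y ^+ 2 / 2) w.
  have -> : (fun y : R => y ^+ 2 / 2) = 2^-1 \*: ((@id R) ^+ 2).
    by apply/funext => y /=; rewrite /GRing.scale/= exprfctE; field.
  by apply: is_derive_eq; rewrite /= /GRing.scale/=; field.
have H' := is_derive1_comp (is_derive_expR _) H.
have -> : stein_sol =
    stein_primitive * (Num.sqrt (2 * pi) \*: (expR \o (fun y => y ^+ 2 / 2))).
  by [].
apply: is_derive_eq; rewrite /stein_deriv /stein_sol /GRing.scale/=.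
have /eqP := inv_p w; rewrite -(inj_eq (mulIf (lt0r_neq0 (gauss_pdf_gt0 w)))).
rewrite mulVf ?lt0r_neq0 ?gauss_pdf_gt0// => /eqP E1.
rewrite [X in _ + X](_ : _ = Num.sqrt (2 * pi) * expR (w ^+ 2 / 2) *
  ((h w - gauss_mean) * p w))//.
rewrite [LHS](_ : _ =
  (h w - gauss_mean) * (Num.sqrt (2 * pi) * expR (w ^+ 2 / 2) * p w) +
  w * (stein_primitive w * (Num.sqrt (2 * pi) * expR (w ^+ 2 / 2))));
  last by ring.
by rewrite E1; ring.
Qed.

Lemma continuous_stein_sol : continuous stein_sol.
Proof.
move=> x; apply: differentiable_continuous; apply/derivable1_diffP.
exact: (@ex_derive _ _ _ _ _ _ _ (is_derive_stein_sol x)).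
Qed.

Lemma stein_mvt x y : exists2 z, `|z - x| <= `|y - x| &
  stein_sol y - stein_sol x = stein_deriv z * (y - x).
Proof.
have cs (D : set R) : {within D, continuous stein_sol}.
  by apply: continuous_subspaceT; exact: continuous_stein_sol.
have ds (a b : R) : forall z : R, z \in `]a, b[%R ->
    is_derive z 1 stein_sol (stein_deriv z).
  by move=> z _; exact: is_derive_stein_sol.
have [xy|yx] := leP x y.
  have [z] := MVT_segment xy (ds x y) (cs _); rewrite in_itv/= => /andP[xz zy] ->.
  by exists z => //; rewrite !ger0_norm ?subr_ge0// lerB.
have [z] := MVT_segment (ltW yx) (ds y x) (cs _).
rewrite in_itv/= => /andP[yz zx] E.
exists z; first by rewrite !ler0_norm ?subr_le0 ?(ltW yx)// lerN2 lerB.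
by rewrite -opprB E; ring.
Qed.

Variable L : R.
Hypothesis h_lip : forall x y, `|h x - h y| <= L * `|x - y|.

(* The variation of the derivative is bounded through the equation itself, so
   no bound on a second derivative is needed; the factor [`|x|] is harmless as
   it is evaluated at [x = W], where [E |W| <= 1]. *)
Lemma stein_taylor x e :
  `|stein_sol x - stein_sol (x - e) - e * stein_deriv x| <=
  (stein_bound + 2 * `|x| + L) * e ^+ 2.
Proof.
have [z zx E] := stein_mvt x (x - e).
have ze : `|z - x| <= `|e|.
  by apply: le_trans zx _; rewrite addrC addKr normrN.
have -> : stein_sol x - stein_sol (x - e) - e * stein_deriv x =
    e * (stein_deriv z - stein_deriv x).
  have -> : stein_sol (x - e) = stein_sol x + stein_deriv z * (x - e - x).
    by rewrite -E; ring.
  by ring.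
(* Subtracting the Stein equations at [z] and [x] leaves [x * (stein_sol z - stein_sol x)], to which
   the mean value theorem is applied once more. *)
have [z' _ E'] := stein_mvt x z.
have -> : stein_deriv z - stein_deriv x = (z - x) * stein_sol z +
    x * (stein_deriv z' * (z - x)) + (h z - h x).
  by rewrite -E' /stein_deriv; ring.
rewrite -[e ^+ 2]real_normK ?num_real// [`|e| ^+ 2]expr2 [leRHS]mulrA.
rewrite normrM mulrC ler_wpM2r//.
have L0 : 0 <= L.
  have := h_lip 1 0; rewrite subr0 normr1 mulr1; exact: le_trans.
rewrite [leRHS]mulrDl [in leRHS]mulrDl.
apply: le_trans (ler_normD _ _) _; apply: lerD; last first.
  by apply: le_trans (h_lip _ _) _; rewrite ler_wpM2l.
apply: le_trans (ler_normD _ _) _; apply: lerD.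
  by rewrite normrM mulrC ler_pM// norm_stein_sol_le.
apply: (@le_trans _ _ (`|x| * (2 * `|e|))); last by rewrite mulrCA mulrA.
by rewrite !normrM ler_wpM2l// ler_pM// norm_stein_deriv_le.
Qed.

End stein_equation.

(** * Piecewise linear smoothing of the indicator of a half-line *)

Section smoothed_indicator.
Context {R : realType}.
Notation mu := (@lebesgue_measure R).
Notation p := (@gauss_pdf R).
Variables (l e : R).
Hypothesis e0 : 0 < e.

Definition ramp (x : R) : R := Num.max 0 (Num.min 1 ((l + e - x) / e)).

Lemma ramp_ge0_le1 x : 0 <= ramp x <= 1.
Proof. by rewrite /ramp le_max lexx/= ge_max ler01 ge_min lexx. Qed.

Lemma ramp1 x : x <= l -> ramp x = 1.
Proof.
move=> xl; have H : 1 <= (l + e - x) / e by rewrite ler_pdivlMr//; lra.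
by rewrite /ramp min_l// max_r.
Qed.

Lemma ramp0 x : l + e <= x -> ramp x = 0.
Proof.
move=> xl; have H : (l + e - x) / e <= 0.
  by rewrite ler_pdivrMr// mul0r; lra.
by rewrite /ramp max_l// ge_min H orbT.
Qed.

(** Clamping to the unit interval is 1-Lipschitz, and the affine function inside has slope
    [- e^-1]. *)
Lemma ramp_lip x y : `|ramp x - ramp y| <= e^-1 * `|x - y|.
Proof.
have clamp_lip (u v : R) :
    `|Num.max 0 (Num.min 1 u) - Num.max 0 (Num.min 1 v)| <= `|u - v|.
  rewrite /Num.max /Num.min ler_norml; have := ler_norm (u - v).
  have := ler_norm (v - u); rewrite (distrC v u).
  by do ![case: ifPn]; rewrite -?leNgt; intros; apply/andP; split; lra.
apply: le_trans (clamp_lip _ _) _.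
rewrite -mulrBl normrM mulrC ger0_norm ?invr_ge0 ?(ltW e0)//.
by rewrite ler_wpM2l ?invr_ge0 ?(ltW e0)//
  (_ : l + e - x - (l + e - y) = y - x) 1?distrC//; ring.
Qed.

Lemma continuous_ramp : continuous ramp.
Proof.
move=> x; apply/cvgrPdist_le => /= r r0; near=> y.
apply: le_trans (ramp_lip _ _) _; rewrite mulrC ler_pdivrMr//.
by near: y; apply: cvgr_dist_le; [exact: cvg_id|exact: mulr_gt0].
Unshelve. all: by end_near. Qed.

Lemma PhiE (x : R) : Phi x = \int[mu]_(t in `]-oo, x]) p t.
Proof. by apply: eq_Rintegral => t _; rewrite gauss_pdfE. Qed.

(** The normal density is at most 1, so an interval of length [y] has Gaussian mass at most [y]. *)
Lemma PhiDr_le (x y : R) : 0 <= y -> Phi (x + y) <= Phi x + y.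
Proof.
move=> y0; rewrite -lerBlDl !PhiE.
rewrite Rintegral_itvB//;
  [|exact: integrable_gauss_pdf|by rewrite bnd_simp lerDl].
apply: (@le_trans _ _ (\int[mu]_(t in `]x, x + y]) 1)).
  apply: le_Rintegral => //.
  - exact: integrable_gauss_pdf.
  - apply/integrableP; split; first exact: measurable_cst.
    under eq_integral do rewrite /= normr1.
    rewrite integral_cst//= mul1e lebesgue_measure_itv/=.
    by case: ifP => _; rewrite ?ltry// -EFinB ltry.
  - by move=> t _; exact: gauss_pdf_le1.
rewrite Rintegral_cst// mul1r /= lebesgue_measure_itv/= lte_fin.
by case: ifP => //= _; rewrite (addrC x) addrK.
Qed.

(** The ramp lies between the indicators of []-oo, l]] and []-oo, l + e]]. *)
Lemma gauss_mean_ramp : Phi l <= gauss_mean ramp <= Phi l + e.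
Proof.
have mramp : measurable_fun setT ramp.
  by apply: continuous_measurable_fun; exact: continuous_ramp.
have ih : mu.-integrable setT (EFin \o (fun x => ramp x * p x)).
  apply: (le_integrable measurableT) (integrable_gauss_pdf measurableT).
    by apply/measurable_EFinP/measurable_funM => //; exact: measurable_gauss_pdf.
  move=> x _ /=; rewrite lee_fin normrM ler_piMl//.
  by have /andP[? ?] := ramp_ge0_le1 x; rewrite ger0_norm.
have ip (x : R) : mu.-integrable setT (EFin \o (p \_ `]-oo, x])).
  rewrite -restrict_EFin; apply/integrable_restrict => //; rewrite setTI.
  exact: integrable_gauss_pdf.
apply/andP; split; last apply: le_trans (PhiDr_le _ (ltW e0)).
  rewrite PhiE Rintegral_mkcond; apply: le_Rintegral => // x _.
  rewrite patchE; case: ifPn => [|_].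
    by rewrite inE/= in_itv/= => xl; rewrite ramp1// mul1r.
  by rewrite mulr_ge0 ?(ltW (gauss_pdf_gt0 x))//; case/andP: (ramp_ge0_le1 x).
rewrite PhiE Rintegral_mkcond; apply: le_Rintegral => // x _.
rewrite patchE; case: ifPn => [_|].
  by rewrite ler_piMl ?(ltW (gauss_pdf_gt0 x))//; case/andP: (ramp_ge0_le1 x).
rewrite notin_setE/= in_itv/= => /negP; rewrite -ltNge => xl.
by rewrite ramp0 ?mul0r// ltW.
Qed.

End smoothed_indicator.

(** * Sums of locally dependent variables *)

Lemma eq_ler (R : numDomainType) (x y : R) : x = y -> x <= y.
Proof. by move=> ->. Qed.

(** The empty set does not even meet itself, in accordance with a variable of empty support being
    independent of everything. *)
Definition meets m (A B : {set 'I_m}) : bool :=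
  [exists i, (i \in A) && (i \in B)].

Lemma meetsPn m (A B : {set 'I_m}) :
  ~~ meets A B -> forall i, i \in A -> i \notin B.
Proof. by move=> /existsPn AB i iA; have := AB i; rewrite iA. Qed.

(** * Counting with weights, over an abstract index type so as to serve both sets and pairs of
    sets *)

Section weighted_supports.
Context {R : realType} {m : nat} {I : finType}.
Variables (s : I -> {set 'I_m}) (v : I -> R) (C : R).
Hypotheses (v0 : forall p, 0 <= v p)
  (vC : forall i, \sum_(p | i \in s p) v p <= C).

(** A union bound over the points of [A]: every support meeting [A] contains one of them. *)
Lemma sum_meets_le (A : {set 'I_m}) :
  \sum_(p | meets A (s p)) v p <= #|A|%:R * C.
Proof.
apply: (@le_trans _ _ (\sum_(i in A) \sum_(p | i \in s p) v p)).
  rewrite (exchange_big_dep xpredT)//= big_mkcond/=; apply: ler_sum => p _.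
  case: ifP => [/existsP[i /andP[iA ip]]|_]; last exact: sumr_ge0.
  rewrite (bigD1 i) ?iA//= lerDl; exact: sumr_ge0.
by apply: (le_trans (ler_sum _ (fun i _ => vC i))); rewrite sumr_const mulr_natl.
Qed.

(** Double counting of the pairs formed by an index and a point of its support. *)
Lemma sum_card_le : \sum_p v p * #|s p|%:R <= m%:R * C.
Proof.
have -> : \sum_p v p * #|s p|%:R = \sum_(i < m) \sum_(p | i \in s p) v p.
  rewrite (exchange_big_dep xpredT)//=; apply: eq_bigr => p _.
  by rewrite sumr_const mulr_natr.
apply: (le_trans (ler_sum _ (fun i _ => vC i))).
by rewrite sumr_const card_ord mulr_natl.
Qed.

End weighted_supports.

(** * Variance of a sum of variables with weighted supports *)

Section variance_bound.
Context {R : realType} {d : measure_display} {T : measurableType d}.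
Variables (P : probability T R) (m : nat) (X : 'I_m -> {RV P >-> R}).
Hypothesis hX : mutually_independent X.
Notation E Z := (Rintegral P setT Z).
Context {I : finType}.
Variables (s : I -> {set 'I_m}) (v : I -> R) (C : R) (Z : I -> T -> R).
Hypotheses (vC : forall i, \sum_(p | i \in s p) v p <= C)
  (mZ : forall p, cyl_measurable X (s p) (Z p))
  (Zv : forall p w, `|Z p w| <= v p).

Let v0 p : 0 <= v p.
Proof. exact: le_trans (Zv p point). Qed.

Let bZ p : bounded_rv (Z p).
Proof. by split; [exact (cyl_measurableW (@mZ p))|exists (v p)]. Qed.

(** Disjoint supports give independent centred factors, hence covariance 0; otherwise each centred
    factor is bounded by twice its weight. *)
Let covariance_le p q :
  E (fun w => (Z p w - E (Z p)) * (Z q w - E (Z q))) <=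
  if meets (s p) (s q) then 4 * (v p * v q) else 0.
Proof.
have bc r : bounded_rv (fun w => Z r w - E (Z r)).
  by apply: bounded_rvB => //; exact: bounded_rv_cst.
have mc r : cyl_measurable X (s r) (fun w => Z r w - E (Z r)).
  by apply: measurable_funB; [exact: mZ|exact: measurable_cst].
case: ifPn => [_|pq].
  apply: le_trans (ler_norm _) _; apply: expect_norm_le_cst.
    exact: bounded_rvM.
  have c2 r w : `|Z r w - E (Z r)| <= 2 * v r.
    apply: le_trans (ler_normB _ _) _.
    have := Zv r w; have := expect_norm_le_cst P (bZ r) (Zv r); lra.
  move=> w; rewrite normrM (_ : 4 * _ = (2 * v p) * (2 * v q)); last by ring.
  by rewrite ler_pM.
rewrite (expectM_cyl hX (meetsPn pq) (bc p) (bc q) (@mc p) (@mc q)).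
rewrite expectB//; last exact: bounded_rv_cst.
by rewrite expect_cst subrr mul0r.
Qed.

Lemma variance_sum_le :
  E (fun w => (\sum_p Z p w - \sum_p E (Z p)) ^+ 2) <= 4 * (m%:R * C ^+ 2).
Proof.
have bc r : bounded_rv (fun w => Z r w - E (Z r)).
  by apply: bounded_rvB => //; exact: bounded_rv_cst.
have -> : (fun w => (\sum_p Z p w - \sum_p E (Z p)) ^+ 2) =
    (fun w => \sum_p \sum_q (Z p w - E (Z p)) * (Z q w - E (Z q))).
  apply/funext => w; rewrite -sumrB expr2 mulr_suml.
  by apply: eq_bigr => p _; rewrite mulr_sumr.
rewrite expect_sum; last first.
  by move=> p; apply: bounded_rv_sum => q; exact: bounded_rvM.
apply: (@le_trans _ _ (\sum_p 4 * (v p * (#|s p|%:R * C)))).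
  apply: ler_sum => p _; rewrite expect_sum; last by move=> q; exact: bounded_rvM.
  apply: (le_trans (ler_sum _ (fun q _ => covariance_le p q))).
  rewrite -big_mkcond/= -mulr_sumr -mulr_sumr.
  by rewrite ler_wpM2l// ler_wpM2l//; exact: sum_meets_le.
rewrite -mulr_sumr ler_wpM2l//.
under eq_bigr do rewrite mulrA; rewrite -mulr_suml expr2 mulrA.
have [C0|C0] := leP 0 C; first by rewrite ler_wpM2r//; exact: sum_card_le.
(* A negative [C] cannot bound a sum of nonnegative weights, so there is no point [i] at all; then
   every support is empty and the sum vanishes. *)
have m0 : m = 0%N.
  apply/eqP; rewrite -leqn0 leqNgt; apply/negP => m0.
  by have := vC (Ordinal m0); rewrite leNgt (lt_le_trans C0)//; exact: sumr_ge0.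
rewrite (_ : \sum_i _ = 0) ?mul0r ?m0 ?mul0r ?mul0r//.
apply: big1 => p _; rewrite (_ : #|s p| = 0%N) ?mulr0//.
apply/eqP; rewrite -leqn0 -[X in (_ <= X)%N]m0.
by rewrite -[X in (_ <= X)%N]card_ord max_card.
Qed.

End variance_bound.

(** * Stein's method for the locally dependent sum *)

Section dependent_sum.
Context {R : realType} {d : measure_display} {T : measurableType d}.
Variables (P : probability T R) (m : nat) (X : 'I_m -> {RV P >-> R}).
Hypothesis hX : mutually_independent X.
Notation E Z := (Rintegral P setT Z).
Variables (a : nat) (wt : {set 'I_m} -> R) (C : R) (Y : {set 'I_m} -> T -> R).
Hypotheses (wtC : forall i : 'I_m, \sum_(A : {set 'I_m} | i \in A) wt A <= C)
  (C0 : 0 <= C)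
  (wta : forall A : {set 'I_m}, (a < #|A|)%N -> wt A = 0)
  (mY : forall A, cyl_measurable X A (Y A))
  (Ywt : forall A w, `|Y A w| <= wt A)
  (EY : forall A, E (Y A) = 0).
Variable sigma : R.
Hypotheses (sigma0 : 0 < sigma)
  (ES2 : E (fun w => (\sum_A Y A w) ^+ 2) = sigma ^+ 2).

Let wt0 A : 0 <= wt A.
Proof. exact: le_trans (Ywt A point). Qed.

Let bY A : bounded_rv (Y A).
Proof. by split; [exact (cyl_measurableW (@mY A))|exists (wt A)]. Qed.

Lemma sigma2_le : sigma ^+ 2 <= 4 * (m%:R * C ^+ 2).
Proof.
rewrite -ES2; have := variance_sum_le hX (s := id) wtC mY Ywt.
by under eq_bigr do rewrite EY; rewrite big1//; under eq_fun do rewrite subr0.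
Qed.

Let N A w := \sum_(B | meets A B) Y B w.
Let b A := \sum_(B | meets A B) wt B.

(** The factor [wt A] stays on both sides because [#|A| <= a] is available only where the weight is
    nonzero. *)
Let wt_b A : wt A * b A <= wt A * (a%:R * C).
Proof.
have [Aa|aA] := leqP #|A| a; last by rewrite wta// !mul0r.
rewrite ler_wpM2l//; apply: le_trans (sum_meets_le (s := id) wt0 wtC A) _.
by rewrite ler_wpM2r// ler_nat.
Qed.

Let b0 A : 0 <= b A. Proof. exact: sumr_ge0. Qed.

Let N_le A w : `|N A w| <= b A.
Proof. by apply: le_trans (ler_norm_sum _ _ _) _; apply: ler_sum. Qed.

(** This controls the total Taylor remainder. One factor [b A] is bounded by [a * C], the other by
    [#|A| * C], so that double counting yields a bound linear in [m]. *)
Let sum_wt_b2 : \sum_A wt A * b A ^+ 2 <= a%:R * C ^+ 3 * m%:R.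
Proof.
apply: (@le_trans _ _ (\sum_A (wt A * #|A|%:R) * (a%:R * C ^+ 2))).
  apply: ler_sum => A _.
  apply: (@le_trans _ _ (wt A * (a%:R * C) * b A)).
    by rewrite expr2 mulrA ler_wpM2r.
  apply: (@le_trans _ _ (wt A * (a%:R * C) * (#|A|%:R * C))).
    rewrite ler_wpM2l ?mulr_ge0//; exact: (sum_meets_le (s := id)).
  by apply: eq_ler; ring.
rewrite -mulr_suml; have := sum_card_le (s := id) wtC => H.
apply: (@le_trans _ _ (m%:R * C * (a%:R * C ^+ 2))).
  by rewrite ler_wpM2r// mulr_ge0// exprn_ge0.
by apply: eq_ler; ring.
Qed.

(* [Q] is studied as a sum over pairs [(A, B)] of meeting sets, with support
   [A :|: B]. *)
Let pair_rv (p : {set 'I_m} * {set 'I_m}) w :=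
  if meets p.1 p.2 then Y p.1 w * Y p.2 w else 0.
Let pair_wt (p : {set 'I_m} * {set 'I_m}) :=
  if meets p.1 p.2 then wt p.1 * wt p.2 else 0.

Let meets_sym (A B : {set 'I_m}) : meets A B = meets B A.
Proof. by apply: eq_existsb => i; rewrite andbC. Qed.

(** A point of [A :|: B] lies in [A] or in [B]; exchanging the two sets shows that both cases
    contribute the same bound [half]. *)
Let pair_wt_sum i :
  \sum_(p | i \in p.1 :|: p.2) pair_wt p <= 2 * (a%:R * C ^+ 2).
Proof.
have half :
    \sum_(A : {set 'I_m} | i \in A) \sum_B pair_wt (A, B) <= a%:R * C ^+ 2.
  apply: (@le_trans _ _ (\sum_(A : {set 'I_m} | i \in A) wt A * (a%:R * C))).
    apply: ler_sum => A _; rewrite /pair_wt/= -big_mkcond/= -mulr_sumr.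
    exact: wt_b.
  rewrite -mulr_suml mulrC expr2 mulrA ler_wpM2l// mulr_ge0//.
have pw0 p : 0 <= pair_wt p.
  by rewrite /pair_wt; case: ifP => // _; rewrite mulr_ge0.
apply: (@le_trans _ _
  (\sum_(p : {set 'I_m} * {set 'I_m} | i \in p.1) pair_wt p +
   \sum_(p : {set 'I_m} * {set 'I_m} | i \in p.2) pair_wt p)).
  rewrite big_mkcond [X in _ <= X + _]big_mkcond [X in _ <= _ + X]big_mkcond.
  rewrite -big_split/=; apply: ler_sum => p _; rewrite inE.
  by case: (i \in p.1); case: (i \in p.2) => //=; rewrite ?addr0 ?add0r// lerDl.
rewrite mulr_natl mulr2n; apply: lerD.
  rewrite (_ : \sum_(p | _) _ =
    \sum_(A : {set 'I_m} | i \in A) \sum_B pair_wt (A, B))//.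
  rewrite pair_big_dep/=; apply: eq_big => [p|[A B]//]; by rewrite andbT.
rewrite (_ : \sum_(p | _) _ =
    \sum_(A : {set 'I_m} | i \in A) \sum_B pair_wt (A, B))//.
rewrite pair_big_dep/=.
rewrite (reindex_inj (h := fun p : _ * _ => (p.2, p.1)))/=; last first.
  by move=> [A B] [A' B'] [-> ->].
apply: eq_big => [p|[A B] _]; first by rewrite andbT.
by rewrite /pair_wt/= meets_sym mulrC.
Qed.

Let Q w := (\sum_A Y A w * N A w) / sigma ^+ 2.

Let sum_pair w : \sum_A Y A w * N A w = \sum_p pair_rv p w.
Proof.
transitivity (\sum_A \sum_B pair_rv (A, B) w).
  apply: eq_bigr => A _.
  by rewrite /pair_rv/= -big_mkcond/= -mulr_sumr.
by rewrite pair_bigA/=; apply: eq_bigr => -[].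
Qed.

Let bpair p : bounded_rv (pair_rv p).
Proof.
rewrite /pair_rv; case: (meets p.1 p.2); first exact: bounded_rvM.
exact: bounded_rv_cst.
Qed.

(** In the expanded square, pairs of sets that do not meet have expectation zero by independence and
    centring. This is the normalization [E Q = 1]. *)
Let E_pair : \sum_p E (pair_rv p) = sigma ^+ 2.
Proof.
rewrite -ES2.
have -> : (fun w => (\sum_A Y A w) ^+ 2) = (fun w => \sum_A \sum_B Y A w * Y B w).
  apply/funext => w; rewrite expr2 mulr_suml.
  by apply: eq_bigr => A _; rewrite mulr_sumr.
rewrite expect_sum; last first.
  by move=> A; apply: bounded_rv_sum => B; exact: bounded_rvM.
transitivity (\sum_A \sum_B E (pair_rv (A, B))).
  by rewrite pair_bigA/=; apply: eq_bigr => -[].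
apply: eq_bigr => A _; rewrite expect_sum; last by move=> B; exact: bounded_rvM.
apply: eq_bigr => B _; rewrite /pair_rv/=; case: (boolP (meets A B)) => // AB.
by rewrite expect_cst (expectM_cyl hX (meetsPn AB))// EY mul0r.
Qed.

Let sigma2_gt0 : 0 < sigma ^+ 2. Proof. exact: exprn_gt0. Qed.

Let bQ : bounded_rv (fun w => 1 - Q w).
Proof.
apply: bounded_rvB; first exact: bounded_rv_cst.
rewrite /Q; under eq_fun do rewrite sum_pair.
by apply: bounded_rvM; [exact: bounded_rv_sum|exact: bounded_rv_cst].
Qed.

(** The variance bound for the pairs, with constant [2 * a * C ^ 2], gives [16 * a ^ 2 * C ^ 4 * m]
    before division by [sigma ^ 4]; the first moment is bounded by the square root. *)
Let E_1Q_le :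
  E (fun w => `|1 - Q w|) <= 4 * a%:R * C ^+ 2 * Num.sqrt m%:R / sigma ^+ 2.
Proof.
apply: expect_norm_le_sqrt => //; last first.
  by rewrite !mulr_ge0 ?invr_ge0 ?(ltW sigma2_gt0)// ?exprn_ge0 ?sqrtr_ge0.
have mp p : cyl_measurable X (p.1 :|: p.2) (pair_rv p).
  rewrite /pair_rv; case: (meets p.1 p.2); last exact: measurable_cst.
  apply: measurable_funM.
    by apply: (cyl_measurable_sub (J := p.1)); [exact: finset.subsetUl|].
  by apply: (cyl_measurable_sub (J := p.2)); [exact: finset.subsetUr|].
have pv p w : `|pair_rv p w| <= pair_wt p.
  rewrite /pair_rv /pair_wt; case: (meets p.1 p.2); last by rewrite normr0.
  by rewrite normrM ler_pM.
have := variance_sum_le hX pair_wt_sum mp pv; rewrite E_pair => V.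
have -> : (fun w => (1 - Q w) ^+ 2) =
    (fun w => (sigma ^+ 2) ^- 2 * (\sum_p pair_rv p w - sigma ^+ 2) ^+ 2).
  apply/funext => w; rewrite /Q sum_pair; field.
  by rewrite lt0r_neq0.
rewrite expectZ; last first.
  under eq_fun do rewrite expr2.
  have H : bounded_rv (fun w => \sum_p pair_rv p w - sigma ^+ 2).
    by apply: bounded_rvB; [exact: bounded_rv_sum|exact: bounded_rv_cst].
  exact: bounded_rvM.
rewrite expr_div_n mulrC ler_wpM2r ?invr_ge0 ?exprn_ge0 ?(ltW sigma0)//.
apply: le_trans V _; rewrite [leRHS]exprMn sqr_sqrtr//.
by apply: eq_ler; ring.
Qed.

Let W w := sigma^-1 * \sum_A Y A w.

Let bW : bounded_rv W.
Proof. by apply: bounded_rvM; [exact: bounded_rv_cst|exact: bounded_rv_sum]. Qed.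

Let E_W_le1 : E (fun w => `|W w|) <= 1.
Proof.
apply: expect_norm_le_sqrt => //; rewrite /W.
under eq_Rintegral do rewrite exprMn.
rewrite expectZ ?ES2; last first.
  under eq_fun do rewrite expr2.
  by apply: bounded_rvM; exact: bounded_rv_sum.
by rewrite -exprMn mulVf ?lt0r_neq0.
Qed.

Section test_function.
Variables (h : R -> R) (L : R).
Hypotheses (ch : continuous h) (h01 : forall x, 0 <= h x <= 1)
  (h_lip : forall x y, `|h x - h y| <= L * `|x - y|).
Notation f := (stein_sol h).
Notation f' := (stein_deriv h).
Notation K0 := (@stein_bound R).

Let mf : measurable_fun setT f.
Proof. by apply: continuous_measurable_fun; exact: continuous_stein_sol. Qed.

Let bf (V : T -> R) : bounded_rv V -> bounded_rv (fun w => f (V w)).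
Proof.
move=> [mV _]; split; first exact: measurableT_comp.
by exists K0 => w; exact: norm_stein_sol_le.
Qed.

Let mh : measurable_fun setT h. Proof. exact: continuous_measurable_fun. Qed.

Let bh (V : T -> R) : bounded_rv V -> bounded_rv (fun w => h (V w)).
Proof.
move=> [mV _]; split; first exact: measurableT_comp.
by exists 1 => w; have /andP[? ?] := h01 (V w); rewrite ger0_norm.
Qed.

Let bN A : bounded_rv (N A). Proof. exact: bounded_rv_sum. Qed.

Let V A w := W w - sigma^-1 * N A w.

Let bV A : bounded_rv (V A).
Proof.
by apply: bounded_rvB => //; apply: bounded_rvM => //; exact: bounded_rv_cst.
Qed.

(** Removing the sets that meet [A] leaves a sum supported on the complement of [A], hence
    independent of [Y A], which has mean zero. *)
Let E_indep A : E (fun w => Y A w * f (V A w)) = 0.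
Proof.
have VE : V A = fun w => sigma^-1 * \sum_(B | ~~ meets A B) Y B w.
  apply/funext => w; rewrite /V /W /N (bigID (meets A))/=; ring.
have AA i : i \in A -> i \notin ~: A by rewrite inE negbK.
rewrite (expectM_cyl hX AA (bY A) (bf (bV A)) (@mY A)) ?EY ?mul0r//.
apply: measurableT_comp; first exact: mf.
rewrite VE; apply: measurable_funM; first exact: measurable_cst.
apply: cyl_measurable_sum => B AB; apply: (cyl_measurable_sub _ (@mY B)).
apply/fintype.subsetP => i iB; rewrite inE; apply/negP => /(meetsPn AB).
by rewrite iB.
Qed.

Let rem A w := f (W w) - f (V A w) - sigma^-1 * N A w * f' (W w).

Let rem_le A w :
  `|rem A w| <= (K0 + 2 * `|W w| + L) * (sigma^-1 ^+ 2 * b A ^+ 2).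
Proof.
apply: le_trans (stein_taylor ch h01 h_lip _ _) _.
have L0 : 0 <= L.
  by have := h_lip 1 0; rewrite subr0 normr1 mulr1; exact: le_trans.
have K00 : 0 <= K0 by apply: le_trans (norm_stein_sol_le ch h01 0).
have c0 : 0 <= K0 + 2 * `|W w| + L by have := normr_ge0 (W w); lra.
rewrite (ler_wpM2l c0)//.
rewrite exprMn ler_wpM2l ?exprn_ge0 ?invr_ge0 ?(ltW sigma0)//.
by rewrite -[N A w ^+ 2]real_normK ?num_real// ler_sqr ?nnegrE.
Qed.

Lemma stein_dependent_sum :
  `|E (fun w => h (W w)) - gauss_mean h| <=
  8 * a%:R * C ^+ 2 * Num.sqrt m%:R / sigma ^+ 2 +
  a%:R * C ^+ 3 * m%:R / sigma ^+ 3 * (K0 + 2 + L).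
Proof.
have bfW := bf bW; have bhW := bh bW.
have bf'W : bounded_rv (fun w => f' (W w)).
  rewrite /stein_deriv; apply: bounded_rvD; first exact: bounded_rvM.
  by apply: bounded_rvB => //; exact: bounded_rv_cst.
have bc r : bounded_rv (fun _ : T => r) by exact: bounded_rv_cst.
have brem A : bounded_rv (rem A).
  apply: bounded_rvB; first by apply: bounded_rvB => //; exact: bf.
  by apply: bounded_rvM => //; apply: bounded_rvM.
pose U1 w := f' (W w) * (1 - Q w).
pose U2 w := \sum_A sigma^-1 * (Y A w * f (V A w)).
pose U3 w := \sum_A sigma^-1 * (Y A w * rem A w).
have bU1 : bounded_rv U1 by exact: bounded_rvM.
have bYf A : bounded_rv (fun w => Y A w * f (V A w)).
  by apply: bounded_rvM => //; exact: bf.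
have bU2 : bounded_rv U2.
  by apply: bounded_rv_sum => A; exact: bounded_rvM.
have bYr A : bounded_rv (fun w => Y A w * rem A w) by exact: bounded_rvM.
have bU3 : bounded_rv U3.
  by apply: bounded_rv_sum => A; exact: bounded_rvM.
(* By the Stein equation [h (W) - gauss_mean h] equals [f' (W) - W * f (W)]. Expanding [f (W)]
   around [V A] in each summand splits it into the fluctuation of [Q] ([U1]), a part of mean zero
   ([U2]) and the Taylor remainders ([U3]). *)
have hE : (fun w => h (W w)) = (fun w => (U1 w - U2 w - U3 w) + gauss_mean h).
  apply/funext => w.
  suff : U1 w - U2 w - U3 w = f' (W w) - W w * f (W w).
    by rewrite /stein_deriv => ->; ring.
  have -> : W w * f (W w) = U2 w + U3 w + f' (W w) * Q w.
    have -> : W w * f (W w) = \sum_A sigma^-1 * (Y A w * f (W w)).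
      by rewrite {1}/W -mulrA mulr_suml mulr_sumr.
    have -> : f' (W w) * Q w = \sum_A f' (W w) * (Y A w * N A w / sigma ^+ 2).
      by rewrite /Q mulr_suml mulr_sumr.
    rewrite /U2 /U3 -!big_split/=; apply: eq_bigr => A _; rewrite /rem; field.
    by rewrite lt0r_neq0.
  by rewrite /U1; ring.
rewrite hE expectD//; last by apply: bounded_rvB => //; exact: bounded_rvB.
rewrite expect_cst addrK expectB//; last exact: bounded_rvB.
rewrite expectB//.
have -> : E U2 = 0.
  rewrite expect_sum; last by move=> A; exact: bounded_rvM.
  by apply: big1 => A _; rewrite expectZ// E_indep mulr0.
rewrite subr0; apply: le_trans (ler_normB _ _) _; apply: lerD.
  (* The bound [|f'| <= 2] doubles the constant 4 of [E_1Q_le] to 8. *)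
  apply: (@le_trans _ _ (E (fun w => 2 * `|1 - Q w|))).
    apply: expect_norm_le => //.
      by apply: bounded_rvM => //; exact: bounded_rv_norm.
    by move=> w; rewrite normrM ler_wpM2r//; exact: norm_stein_deriv_le.
  rewrite expectZ; last exact: bounded_rv_norm.
  by have := E_1Q_le; set x := _ / _; rewrite /x; lra.
(* One factor [sigma^-1] comes from [W], the other two from the squared increment in the Taylor
   remainder. *)
pose B3 := sigma^-1 ^+ 3 * \sum_A wt A * b A ^+ 2.
have B30 : 0 <= B3.
  rewrite mulr_ge0 ?exprn_ge0 ?invr_ge0 ?(ltW sigma0)//.
  by apply: sumr_ge0 => A _; rewrite mulr_ge0 ?exprn_ge0.
apply: (@le_trans _ _ (E (fun w => B3 * (2 * `|W w| + (K0 + L))))).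
  have bWn := bounded_rv_norm bW.
  apply: expect_norm_le => //.
    apply: bounded_rvM => //; apply: bounded_rvD => //; exact: bounded_rvM.
  move=> w; apply: le_trans (ler_norm_sum _ _ _) _.
  rewrite /B3 mulrAC mulr_sumr; apply: ler_sum => A _.
  rewrite normrM normrM ger0_norm ?invr_ge0 ?(ltW sigma0)//.
  apply: (@le_trans _ _ (sigma^-1 * (wt A *
      ((K0 + 2 * `|W w| + L) * (sigma^-1 ^+ 2 * b A ^+ 2))))).
    rewrite ler_wpM2l ?invr_ge0 ?(ltW sigma0)// ler_pM//; exact: rem_le.
  by apply: eq_ler; ring.
have bWn := bounded_rv_norm bW.
have b2W : bounded_rv (fun w => 2 * `|W w|) by exact: bounded_rvM.
rewrite expectZ; last exact: bounded_rvD.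
rewrite expectD// expectZ// expect_cst.
have L0 : 0 <= L.
  by have := h_lip 1 0; rewrite subr0 normr1 mulr1; exact: le_trans.
have K00 : 0 <= K0 by apply: le_trans (norm_stein_sol_le ch h01 0).
apply: ler_pM => //.
- have : 0 <= E (fun w => `|W w|) by apply: Rintegral_ge0.
  by lra.
- rewrite /B3 exprVn mulrC ler_wpM2r ?invr_ge0 ?exprn_ge0 ?(ltW sigma0)//.
- by have := E_W_le1; lra.
Qed.

End test_function.

(** The indicator is squeezed between the ramps starting at [lam - e] and at [lam]. Smoothing costs
    [e] on either side, and [stein_dependent_sum] applies with Lipschitz constant [e^-1]. *)
Lemma kolmogorov_dependent_sum (e lam : R) : 0 < e ->
  `|fine (P [set w | W w < lam]) - Phi lam| <= e +
  (8 * a%:R * C ^+ 2 * Num.sqrt m%:R / sigma ^+ 2 +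
   a%:R * C ^+ 3 * m%:R / sigma ^+ 3 * (@stein_bound R + 2 + e^-1)).
Proof.
move=> e0; set delta := (X in e + X).
have mD : measurable [set w | W w < lam].
  have -> : [set w | W w < lam] = W @^-1` `]-oo, lam[.
    by apply/seteqP; split => w /=; rewrite in_itv.
  by rewrite -[X in measurable X]setTI; apply: bW.1.
have -> : fine (P [set w | W w < lam]) = E (\1_[set w | W w < lam]).
  by rewrite /Rintegral integral_indic// setIT.
have b1 : bounded_rv (\1_[set w | W w < lam] : T -> R).
  split; first exact: measurable_indic.
  by exists 1 => w; rewrite indicE; case: (_ \in _); rewrite ?normr1 ?normr0.
have br (l : R) : bounded_rv (fun w => ramp l e (W w)).
  split.
    apply: measurableT_comp; last exact: bW.1.
    by apply: continuous_measurable_fun; exact: continuous_ramp.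
  by exists 1 => w; have /andP[? ?] := ramp_ge0_le1 l e (W w); rewrite ger0_norm.
have S (l : R) : `|E (fun w => ramp l e (W w)) - gauss_mean (ramp l e)| <= delta.
  by apply: stein_dependent_sum;
    [exact: continuous_ramp|exact: ramp_ge0_le1|exact: ramp_lip].
have up : E (\1_[set w | W w < lam]) <= E (fun w => ramp lam e (W w)).
  apply: expect_le => // w; rewrite indicE; case: (boolP (_ \in _)) => [|_].
    by rewrite inE/= => /ltW ?; rewrite ramp1.
  by case/andP: (ramp_ge0_le1 lam e (W w)).
have lo : E (fun w => ramp (lam - e) e (W w)) <= E (\1_[set w | W w < lam]).
  apply: expect_le => // w; rewrite indicE; case: (boolP (_ \in _)) => [_|].
    by case/andP: (ramp_ge0_le1 (lam - e) e (W w)).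
  rewrite notin_setE/= => /negP; rewrite -leNgt => lw.
  by rewrite ramp0// subrK.
have := S lam; have := S (lam - e).
rewrite !ler_norml => /andP[S1 S2] /andP[S3 S4].
have /andP[G1 G2] := gauss_mean_ramp lam e0.
have /andP[G3 G4] := gauss_mean_ramp (lam - e) e0.
have := PhiDr_le (lam - e) (ltW e0); rewrite subrK => G5.
by apply/andP; split; lra.
Qed.

End dependent_sum.

(** * The theorem *)

Lemma ae_eq_sum (R : realType) (d : measure_display) (T : measurableType d)
    (P : probability T R) (I : Type) (s : seq I) (F G : I -> T -> R) :
  (forall i, ae_eq P setT (F i) (G i)) ->
  ae_eq P setT (fun w => \sum_(i <- s) F i w) (fun w => \sum_(i <- s) G i w).
Proof.
move=> FG; elim: s => [|i s ih].
  by apply: aeW => w _; rewrite !big_nil.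
apply: filterS2 (FG i) ih => w Fi ih /= _.
by rewrite !big_cons Fi// ih.
Qed.

Definition clamp (R : realDomainType) (r x : R) : R :=
  Num.max (- r) (Num.min r x).

Lemma norm_clamp_le (R : realDomainType) (r x : R) : 0 <= r -> `|clamp r x| <= r.
Proof.
move=> r0; rewrite ler_norml /clamp le_max lexx/= ge_max ge_min lexx/=.
by rewrite andbT ge0_cp.
Qed.

Lemma clamp_id (R : realDomainType) (r x : R) : `|x| <= r -> clamp r x = x.
Proof.
by rewrite ler_norml => /andP[rx xr]; rewrite /clamp min_r// max_r.
Qed.

(** The upper bound goes through the ramp of width 1, whose Gaussian mean dominates [Phi x] and is
    at most 1. *)
Lemma Phi_ge0_le1 (R : realType) (x : R) : 0 <= Phi x <= 1.
Proof.
apply/andP; split.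
  by rewrite PhiE; apply: Rintegral_ge0 => t _; exact/ltW/gauss_pdf_gt0.
have /andP[+ _] := gauss_mean_ramp x (@ltr01 R).
have := gauss_mean_ge0_le1 (@continuous_ramp R x 1 ltr01) (ramp_ge0_le1 x 1).
by move=> /andP[_ ?] /le_trans; apply.
Qed.

(* Here [r] stands for [m ^ (1/4)] and [r ^+ 3 / sigma ^+ 2] for the smoothing
   scale. *)
Lemma error_terms_le (R : realType) (A2 A3 C K0 r sigma : R) :
  0 <= A2 -> 0 <= A3 -> 0 <= C -> 0 <= K0 -> 1 <= r -> 0 < sigma ->
  sigma <= 2 * r ^+ 2 * C -> r ^+ 3 / sigma ^+ 2 <= 1 ->
  r ^+ 3 / sigma ^+ 2 + (A2 * r ^+ 2 / sigma ^+ 2 +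
    A3 * r ^+ 4 / sigma ^+ 3 * (K0 + 2 + (r ^+ 3 / sigma ^+ 2)^-1)) <=
  (1 + A2 + A3 * (K0 + 2) + 2 * A3 * C) * (r ^+ 3 / sigma ^+ 2).
Proof.
move=> A20 A30 C0 K00 r1 s0 sC e1; set e := r ^+ 3 / sigma ^+ 2.
have r0 : 0 < r by exact: lt_le_trans r1.
have s2 : 0 < sigma ^+ 2 by exact: exprn_gt0.
have e0 : 0 <= e by rewrite divr_ge0// ?exprn_ge0// ltW.
(* From [r >= 1] and [r ^ 3 <= sigma ^ 2] it follows that [r ^ 2 <= sigma ^ 2]. *)
have rs : r <= sigma.
  rewrite -ler_sqr ?nnegrE ?(ltW r0) ?(ltW s0)//.
  move: e1; rewrite ler_pdivrMr// mul1r; apply: le_trans.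
  by rewrite [leRHS]exprS ler_peMl// exprn_ge0// ltW.
have t1 : r ^+ 2 / sigma ^+ 2 <= e.
  rewrite /e ler_wpM2r ?invr_ge0 ?(ltW s2)// [leRHS]exprS.
  by rewrite ler_peMl// exprn_ge0// ltW.
have t2 : r ^+ 4 / sigma ^+ 3 <= e.
  have -> : r ^+ 4 / sigma ^+ 3 = e * (r / sigma).
    by rewrite /e; field; rewrite lt0r_neq0.
  by rewrite ler_piMr// ler_pdivrMr// mul1r.
(* The term with the Lipschitz constant [e^-1] is the only one that needs the upper bound on
   [sigma]: it equals [e * (sigma / r ^ 2)]. *)
have t3 : r ^+ 4 / sigma ^+ 3 * e^-1 <= 2 * C * e.
  have -> : r ^+ 4 / sigma ^+ 3 * e^-1 = e * (sigma / r ^+ 2).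
    by rewrite /e; field; rewrite !lt0r_neq0.
  rewrite mulrC ler_wpM2r// ler_pdivrMr ?exprn_gt0//.
  by rewrite mulrAC.
have u1 := ler_wpM2l A20 t1.
have u2 := ler_wpM2l (mulr_ge0 A30 (addr_ge0 K00 (ler0n R 2))) t2.
have u3 := ler_wpM2l A30 t3.
have -> : A2 * r ^+ 2 / sigma ^+ 2 + A3 * r ^+ 4 / sigma ^+ 3 * (K0 + 2 + e^-1) =
  A2 * (r ^+ 2 / sigma ^+ 2) + A3 * (K0 + 2) * (r ^+ 4 / sigma ^+ 3) +
  A3 * (r ^+ 4 / sigma ^+ 3 * e^-1) by ring.
apply: (le_trans (lerD (lexx e) (lerD (lerD u1 u2) u3))).
by apply: eq_ler; ring.
Qed.

Theorem theorem9 (R : realType) (a : nat) (c : R) (ha : (2 <= a)%N)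
    (hc : 0 < c) :
  exists K : R, 0 < K /\
    forall (m : nat) (ham : (a <= m)%N)
      (d : measure_display) (T : measurableType d) (P : probability T R)
      (X : 'I_m -> {RV P >-> R}) (hX : mutually_independent X)
      (f : forall A : {set 'I_m}, #|A|.-tuple R -> R)
      (hf : forall A : {set 'I_m}, (#|A| <= a)%N ->
        measurable_fun [set: #|A|.-tuple R] (f A))
      (hmean : forall A : {set 'I_m}, (#|A| <= a)%N ->
        ('E_P[fun w => f A (subvector X A w)] = 0)%E)
      (hbound : forall A : {set 'I_m}, (#|A| <= a)%N ->
        {ae P, forall w,
          `|f A (subvector X A w)| <= expR (- (c * (diam A)%:R))})
      (sigma : R) (hsigma : 0 < sigma)
      (hvar : ('E_P[fun w =>
          ((\sum_(A : {set 'I_m} | (#|A| <= a)%N) f A (subvector X A w)) ^+ 2)%R]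
        = (sigma ^+ 2)%:E)%E)
      (lambda : R),
    `|fine (P [set w | sigma^-1 *
          (\sum_(A : {set 'I_m} | (#|A| <= a)%N) f A (subvector X A w)) < lambda])
      - Phi lambda|
    <= K * (ln m%:R `^ (1 / 4) * (m%:R `^ (3 / 4) / sigma ^+ 2)).

Proof.
have a0 : (0 < a)%N by exact: leq_trans ha.
pose C := weight_const a c; pose K0 : R := stein_bound.
have C0 : 0 <= C by exact: expR_ge0.
have K00 : 0 <= K0.
  by rewrite addr_ge0// invr_ge0; exact/ltW/gauss_pdf_gt0.
pose A2 := 8 * a%:R * C ^+ 2; pose A3 := a%:R * C ^+ 3.
have A20 : 0 <= A2 by rewrite /A2 !mulr_ge0// exprn_ge0.
have A30 : 0 <= A3 by rewrite /A3 mulr_ge0// exprn_ge0.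
pose K1 := 1 + A2 + A3 * (K0 + 2) + 2 * A3 * C.
have K11 : 1 <= K1.
  have H1 : 0 <= A3 * (K0 + 2) by rewrite mulr_ge0// addr_ge0.
  have H2 : 0 <= A3 * C by rewrite mulr_ge0.
  by rewrite /K1; lra.
have ln2 : 0 < ln (2 : R) by apply: ln_gt0; rewrite ltr1n.
(* Since [m >= 2], the logarithmic factor of the claim is at least [l2]; dividing the constant by
   [l2] absorbs it. *)
pose l2 := ln (2 : R) `^ (1 / 4).
have l20 : 0 < l2 by exact: powR_gt0.
exists (K1 / l2); split; first by rewrite divr_gt0//; exact: lt_le_trans K11.
move=> m ham d T P X hX f hf hmean hbound sigma hsigma hvar lam.
have m2 : (2 <= m)%N by exact: leq_trans ham.
pose r : R := m%:R `^ (1 / 4).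
have r1 : 1 <= r.
  have p1 : (1 : R) `^ (1 / 4) = 1 by rewrite powR1.
  rewrite /r -[leLHS]p1 ge0_ler_powR ?nnegrE// ?divr_ge0//.
  by rewrite ler1n (leq_trans _ m2).
have r0 : 0 <= r by exact: le_trans r1.
have rX k : r ^+ k = m%:R `^ (k%:R / 4).
  by rewrite -powR_mulrn// -powRrM mulrC mul1r.
have r2 : r ^+ 2 = Num.sqrt m%:R.
  by rewrite rX -powR12_sqrt//; congr (_ `^ _); field.
have r3 : m%:R `^ (3 / 4) = r ^+ 3 by rewrite rX.
have r4 : r ^+ 4 = m%:R.
  by rewrite -[4%N]/(2 * 2)%N exprM r2 sqr_sqrtr.
rewrite r3; set e := r ^+ 3 / sigma ^+ 2.
have e0 : 0 < e by rewrite divr_gt0// exprn_gt0// (lt_le_trans ltr01).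
set D := `|_ - _|.
suff DK : D <= K1 * e.
  apply: (le_trans DK); rewrite -mulrA ler_wpM2l ?(le_trans ler01 K11)//.
  rewrite mulrA ler_peMl ?(ltW e0)// mulrC ler_pdivlMr// [leLHS]mul1r.
  rewrite /l2 ge0_ler_powR ?nnegrE ?divr_ge0 ?(ltW ln2)//.
    by apply: ln_ge0; rewrite ler1n (leq_trans _ m2).
  by rewrite ler_ln ?posrE ?ltr0n ?(leq_trans _ m2)// ler_nat.
(* Clamping turns the almost sure bound into one valid everywhere, and extension by 0 allows sums
   over all sets. [Y] agrees almost surely with the unclamped [g] below, so means, variance and
   distribution are unaffected. *)
pose Y (A : {set 'I_m}) w :=
  if (#|A| <= a)%N then clamp (weight a c A) (f A (subvector X A w)) else 0.
have msub (A : {set 'I_m}) : (#|A| <= a)%N ->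
    cyl_measurable X A (fun w => f A (subvector X A w)).
  by move=> Aa; apply: cyl_measurable_subvector; exact: hf.
have mY A : cyl_measurable X A (Y A).
  rewrite /Y; case: (boolP (#|A| <= a)%N) => Aa; last exact: measurable_cst.
  apply: measurable_maxr; first exact: measurable_cst.
  by apply: measurable_minr; [exact: measurable_cst|exact: msub].
have Ywt A w : `|Y A w| <= weight a c A.
  rewrite /Y; case: ifP => _; last by rewrite normr0 weight_ge0.
  by rewrite norm_clamp_le// weight_ge0.
have mY' A : measurable_fun setT (Y A) by exact (cyl_measurableW (@mY A)).
pose g (A : {set 'I_m}) w := if (#|A| <= a)%N then f A (subvector X A w) else 0.
have mg A : measurable_fun setT (g A).
  rewrite /g; case: (boolP (#|A| <= a)%N) => Aa; last exact: measurable_cst.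
  exact (cyl_measurableW (@msub A Aa)).
have gY A : ae_eq P setT (g A) (Y A).
  rewrite /g /Y; case: (boolP (#|A| <= a)%N) => Aa; last exact: aeW.
  apply: filterS (hbound A Aa) => w fw _ /=.
  by rewrite clamp_id// /weight Aa.
have bY A : bounded_rv (Y A) by split=> //; exists (weight a c A).
have EY A : Rintegral P setT (Y A) = 0.
  case: (boolP (#|A| <= a)%N) => Aa; last first.
    by rewrite /Y (negbTE Aa) expect_cst.
  have := hmean A Aa; rewrite expectation.unlock => H.
  apply: EFin_inj; rewrite -expect_EFin// -[RHS]H.
  apply: ae_eq_integral => //.
  - exact/measurable_EFinP.
  - by apply/measurable_EFinP; exact (cyl_measurableW (@msub A Aa)).
  - apply: filterS (gY A) => w + _ => /(_ I) /= <-.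
    by rewrite /g Aa.
pose S w := \sum_(A : {set 'I_m}) Y A w.
pose G w := \sum_(A : {set 'I_m}) g A w.
have GE w : \sum_(A : {set 'I_m} | (#|A| <= a)%N) f A (subvector X A w) = G w.
  by rewrite big_mkcond.
have GS : ae_eq P setT G S by exact: ae_eq_sum.
have mG : measurable_fun setT G by exact: measurable_sum.
have mS : measurable_fun setT S by exact: measurable_sum.
have ES2 : Rintegral P setT (fun w => S w ^+ 2) = sigma ^+ 2.
  have bS : bounded_rv S by exact: bounded_rv_sum.
  apply: EFin_inj; rewrite -expect_EFin; last first.
    by under eq_fun do rewrite expr2; exact: bounded_rvM.
  rewrite -hvar expectation.unlock; apply: ae_eq_integral => //.
  - by apply/measurable_EFinP; exact: measurable_funX.
  - under eq_fun do rewrite GE.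
    by apply/measurable_EFinP; exact: measurable_funX.
  - by apply: filterS GS => w + _ => /(_ I) GSw; rewrite GE GSw.
have mlt (H : T -> R) : measurable_fun setT H ->
    measurable [set w | sigma^-1 * H w < lam].
  move=> mH; have mM : measurable_fun setT (fun w => sigma^-1 * H w).
    exact: measurable_funM.
  have -> : [set w | sigma^-1 * H w < lam] =
      (fun w => sigma^-1 * H w) @^-1` `]-oo, lam[.
    by apply/seteqP; split => w /=; rewrite in_itv.
  by rewrite -[X in measurable X]setTI; apply: mM.
have PE : P [set w | sigma^-1 * (\sum_(A : {set 'I_m} | (#|A| <= a)%N)
      f A (subvector X A w)) < lam] = P [set w | sigma^-1 * S w < lam].
  under eq_set do rewrite GE.
  (* Probabilities are rewritten as integrals of indicators, so that almost sure equality of the two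
     sums can be used. *)
  have P1 (B : set T) : measurable B -> P B = (\int[P]_w (\1_B w)%:E)%E.
    by move=> mB; rewrite integral_indic// setIT.
  rewrite !P1; [|exact: mlt|exact: mlt].
  apply: ae_eq_integral => //.
  - by apply/measurable_EFinP/measurable_indic; exact: mlt.
  - by apply/measurable_EFinP/measurable_indic; exact: mlt.
  - apply: filterS GS => w + _ => /(_ I) GSw.
    by rewrite /= !indicE; congr ((nat_of_bool _)%:R%:E);
      apply/idP/idP; rewrite !inE/= GSw.
have mSlam := mlt _ mS.
rewrite /D PE.
(* If [e >= 1] the bound is trivial, both quantities lying in the unit interval and [K1] being at
   least 1; otherwise [e] serves as the smoothing scale. *)
have [e1|e1] := leP 1 e.
  apply: (@le_trans _ _ 1); last by rewrite mulr_ege1.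
  have /andP[p0 p1] := Phi_ge0_le1 lam.
  set q := fine _.
  have q0 : 0 <= q by exact: fine_ge0.
  have q1 : q <= 1.
    rewrite -[leRHS]/(fine 1%:E) fine_le ?fin_num_measure//.
    exact: probability_le1.
  by rewrite ler_norml; apply/andP; split; lra.
have wtC := sum_weight_le (m := m) a0 hc.
have wta (A : {set 'I_m}) : (a < #|A|)%N -> weight a c A = 0.
  by rewrite ltnNge /weight => /negbTE ->.
have s2 := sigma2_le hX wtC mY Ywt EY ES2.
(* The square root of [sigma ^ 2 <= 4 * m * C ^ 2], with [m = r ^ 4]. *)
have sC : sigma <= 2 * r ^+ 2 * C.
  rewrite -ler_sqr ?nnegrE ?(ltW hsigma)//; last by rewrite !mulr_ge0// exprn_ge0.
  apply: (le_trans s2); apply: eq_ler.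
  by rewrite -/C -r4; ring.
apply: (le_trans
  (kolmogorov_dependent_sum hX wtC C0 wta mY Ywt EY hsigma ES2 lam e0)).
rewrite -r2 -r4; exact: error_terms_le (ltW e1).
Qed.
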